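(* Let $m\ge2$ be an integer and $l$ an integer with $l\ge s(m)e^{s(m)}$. Then $D_{m,l}\ge e^{\kappa_m ml}$. Further, \[ \kappa_m\ge w_{\frac{m+1}{2}}\!\left(s(m)e^{s(m)}\right)\frac1m\sum_{\substack{p\le\frac{m+1}{2}\\ p\text{ prime}}}\left(\left\lfloor\frac{m+1}{p}\right\rfloor-1\right)\frac{\log p}{p-1}, \] and \[ \lim_{m\to\infty}\kappa_m=\kappa=\sum_{p\text{ prime}}\frac{\log p}{p(p-1)}=0.75536661083\dots. \]
   Context: $v_p$ is the $p$-adic valuation. $s(2)=e$, $s(m)=m(\log m)^2$ for $m\ge3$. For real $y>1$, $x>1$, $w_y(x)=1-\frac yx-\frac{y-1}{\log y}\frac{\log x}{x}$. $D_{m,l}=\prod_{p\le (m+1)/2,\ p\text{ prime}}p^{\mu_p v_p((l-1)!)}$ with $\mu_p=\min_{0\le j\le m}(\lfloor j/p\rfloor+\lfloor (m-j)/p\rfloor)$, and $\kappa_m=\frac1m\sum_{p\le (m+1)/2,\ p\text{ prime}}\mu_p\frac{\log p}{p-1}w_p(s(m)e^{s(m)})$. *)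

(* Defs.v *)
From HB Require Import structures.
From mathcomp Require Import all_boot all_order all_algebra.
From mathcomp Require Import all_classical all_reals all_analysis.
Set Implicit Arguments. Unset Strict Implicit. Unset Printing Implicit Defensive.
Import Order.TTheory GRing.Theory Num.Theory.
Import numFieldNormedType.Exports.
Local Open Scope ring_scope.

(* mu_p = min_{0<=j<=m} (floor(j/p) + floor((m-j)/p)).  The neutral element m
   of minn is harmless: the j = 0 term is m %/ p <= m. *)
Definition mu (m p : nat) : nat :=
  \big[minn/m]_(j < m.+1) (j %/ p + (m - j) %/ p)%N.

(* D_{m,l} = prod_{p <= (m+1)/2, p prime} p^(mu_p * v_p((l-1)!)).
   For integer p, p <= (m+1)/2 iff p <= (m+1)./2 (floor). *)
Definition D (m l : nat) : nat :=
  (\prod_(p < ((m + 1)./2).+1 | prime p) p ^ (mu m p * logn p (l - 1)`!))%N.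

Section Reals.
Variable R : realType.

Definition s (m : nat) : R :=
  if m == 2%N then expR 1 else m%:R * (ln (m%:R : R)) ^+ 2.

Definition w (y x : R) : R := 1 - y / x - (y - 1) / ln y * (ln x / x).

Definition kappa_m (m : nat) : R :=
  (m%:R)^-1 * \sum_(p < ((m + 1)./2).+1 | prime p)
      (mu m p)%:R * (ln (p%:R : R) / (p%:R - 1)) * w p%:R (s m * expR (s m)).

Definition kappa_term (k : nat) : R :=
  if prime k then ln (k%:R : R) / (k%:R * (k%:R - 1)) else 0.

Definition kappa : R := limn (series kappa_term : R ^nat).
(* the convergence of the series to this value is part of the theorem *)

(* 0.75536661083 = 75536661083 / 10^11 *)
Definition kappa_approx : R :=
  (755%:R * 10%:R ^+ 8 + 366%:R * 10%:R ^+ 5 + 610%:R * 10%:R ^+ 2 + 83%:R)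
    / 10%:R ^+ 11.

End Reals.

(* Main.v *)
(** For [p <= (m+1)/2] the minimum [mu_p] is attained at [j = p-1] and equals
    [floor((m+1)/p) - 1].  Legendre's formula, truncated at the largest power of
    [p] not exceeding [l], gives [(p-1) v_p((l-1)!) >= l w_p(l)]; as [w_p(x)]
    increases with [x >= e] and decreases with [p], this yields both lower
    bounds.  The limit follows by comparing [mu_p / m] with [1/p], since
    [w_((m+1)/2)(s(m) e^s(m)) >= 1 - 61/m].

    For the numerical value, Moebius inversion of [sum_(k>=2) x^k], stopped
    after [k = 6], gives, with [S_k := sum_p log p / (p^k - 1)],
      [kappa = S_2 + S_3 + S_5 - S_6 + sum_p log p * r(p)],
    where [0 <= r(p) <= 2/p^7].  Moreover [S_k = - zeta'(k) / zeta(k)], and the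
    series [sum n^-k] and [sum log n * n^-k] are computed by Euler-Maclaurin
    summation from [N = 256] with remainder bounds, in interval arithmetic over
    fixed-point integers. *)
Require Import Defs.
From HB Require Import structures.
From Stdlib Require Import ZArith.
From mathcomp Require Import all_boot all_order all_algebra.
From mathcomp Require Import ssrZ zify ring lra.
From mathcomp Require Import all_classical all_reals all_analysis.
Import Order.TTheory GRing.Theory Num.Theory.
Import numFieldNormedType.Exports.
Local Open Scope classical_set_scope.
Local Open Scope ring_scope.
Set Implicit Arguments. Unset Strict Implicit. Unset Printing Implicit Defensive.

(** * Euler-Maclaurin summation *)

(** Direct summation over primes cannot reach eleven digits: the tail of the series beyond [x] is of
    order [1/x]. The sums [S_k] remove the obstacle, because they are quotients of series over all
    integers, where Euler-Maclaurin applies. The coefficients [0, 1, 1, 0, 1, -1] of [S_1, ..., S_6]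
    are [[k = 1]] minus the Moebius function at [k]. Hence the divergent [S_1] does not occur, [S_4]
    drops out, and the first neglected power is [p^-7]. The relation between [S_k] and [zeta] is
    obtained without an Euler product and without differentiating [zeta]: [- zeta'(k)] only occurs
    as the series of [log n * n^-k], in which [log n] is split into prime contributions. No integral
    occurs either. The remainders of Euler-Maclaurin and of the logarithm series are both bounded by
    comparing derivatives with the lemma below. *)

Lemma derive_le (R : realType) (g dg h dh : R -> R) (a b : R) :
  (forall x, a <= x <= b -> is_derive x 1 g (dg x)) ->
  (forall x, a <= x <= b -> is_derive x 1 h (dh x)) ->
  (forall x, a <= x <= b -> dg x <= dh x) -> g a <= h a ->
  forall x, a <= x <= b -> g x <= h x.
Proof.
move=> Dg Dh dgh gha x /andP[ax xb].
have D y : a <= y <= b -> is_derive y 1 (h - g) (dh y - dg y).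
  by move=> yab; apply: is_deriveB; [apply: Dh | apply: Dg].
have [y||c cax] := @MVT_segment R (h - g) (dh - dg) a x ax.
- rewrite in_itv/= => /andP[ay yx]; apply: D.
  by rewrite (ltW ay) (le_trans (ltW yx)).
- apply: derivable_within_continuous => y; rewrite in_itv/= => /andP[ay yx].
  by case: (D y); rewrite ?ay ?(le_trans yx).
rewrite !fctE => E; have : 0 <= (dh c - dg c) * (x - a).
  rewrite mulr_ge0 ?subr_ge0// dgh//.
  by move: cax; rewrite in_itv/= => /andP[-> /le_trans->].
by rewrite -E; lra.
Qed.

(** The error of the corrected trapezoidal rule on [[x, y]], as a function [e] of [y], has third
    derivative [(y - x)^2 * f4 y / 12]. Its sign and size are carried back to [e] by three
    comparisons of derivatives. *)
Lemma euler_maclaurin_step (R : realType) (F f f1 f2 f3 f4 : R -> R) (x : R) :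
  (forall y, x <= y <= x + 1 -> is_derive y 1 F (f y)) ->
  (forall y, x <= y <= x + 1 -> is_derive y 1 f (f1 y)) ->
  (forall y, x <= y <= x + 1 -> is_derive y 1 f1 (f2 y)) ->
  (forall y, x <= y <= x + 1 -> is_derive y 1 f2 (f3 y)) ->
  (forall y, x <= y <= x + 1 -> is_derive y 1 f3 (f4 y)) ->
  (forall y, x <= y <= x + 1 -> 0 <= f4 y) ->
  0 <= F (x + 1) - F x - (f x + f (x + 1)) / 2 + (f1 (x + 1) - f1 x) / 12
    <= (f3 (x + 1) - f3 x) / 144.
Proof.
move=> DF Df Df1 Df2 Df3 f4_ge0.
(* [e] vanishes to third order at [x] and its third derivative is [e3 >= 0]. *)
pose e y := F y - F x - (y - x) * (f x + f y) / 2 +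
  (y - x) ^+ 2 * (f1 y - f1 x) / 12.
pose e1 y := (f y - f x) / 2 - (y - x) * f1 y / 3 - (y - x) * f1 x / 6 +
  (y - x) ^+ 2 * f2 y / 12.
pose e2 y := (f1 y - f1 x) / 6 - (y - x) * f2 y / 6 + (y - x) ^+ 2 * f3 y / 12.
pose e3 y := (y - x) ^+ 2 * f4 y / 12.
have De y : x <= y <= x + 1 -> is_derive y 1 e (e1 y).
  move=> hy; have ? := DF y hy; have ? := Df y hy; have ? := Df1 y hy.
  by apply: is_derive_eq; rewrite /e1 /GRing.scale/=; field.
have De1 y : x <= y <= x + 1 -> is_derive y 1 e1 (e2 y).
  move=> hy; have ? := Df2 y hy; have ? := Df y hy; have ? := Df1 y hy.
  by apply: is_derive_eq; rewrite /e2 /GRing.scale/=; field.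
have De2 y : x <= y <= x + 1 -> is_derive y 1 e2 (e3 y).
  move=> hy; have ? := Df2 y hy; have ? := Df3 y hy; have ? := Df1 y hy.
  by apply: is_derive_eq; rewrite /e3 /GRing.scale/=; field.
have x1 : x <= x <= x + 1 by lra.
have xx : x <= x + 1 <= x + 1 by lra.
have D0 y : x <= y <= x + 1 -> is_derive y 1 (cst 0 : R -> R) ((cst 0 : R -> R) y).
  by move=> _; exact: is_derive_cst.
have f3x y : x <= y <= x + 1 -> f3 x <= f3 y.
  by apply: (@derive_le R (cst (f3 x)) (cst 0) f3 f4).
have f3x1 y : x <= y <= x + 1 -> f3 y <= f3 (x + 1).
  move=> /andP[xy yx1].
  apply: (@derive_le R (cst (f3 y)) (cst 0) f3 f4 y (x + 1)) => //=.
  - by move=> z /andP[yz zx]; apply: Df3; rewrite (le_trans xy).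
  - by move=> z /andP[yz zx]; apply: f4_ge0; rewrite (le_trans xy).
  - by rewrite yx1 lexx.
have e3_ge0 y : x <= y <= x + 1 -> 0 <= e3 y.
  by move=> /f4_ge0 ?; rewrite /e3 divr_ge0// mulr_ge0 ?sqr_ge0.
have e2x : e2 x = 0 by rewrite /e2; ring.
have e1x : e1 x = 0 by rewrite /e1; ring.
have ex : e x = 0 by rewrite /e; ring.
have e2_ge0 y : x <= y <= x + 1 -> 0 <= e2 y.
  by apply: (derive_le D0 De2) => //=; rewrite e2x.
have e1_ge0 y : x <= y <= x + 1 -> 0 <= e1 y.
  by apply: (derive_le D0 De1) => //=; rewrite e1x.
have e_ge0 : 0 <= e (x + 1).
  by apply: (derive_le D0 De) => //=; rewrite ex.
have -> : F (x + 1) - F x - (f x + f (x + 1)) / 2 + (f1 (x + 1) - f1 x) / 12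
    = e (x + 1) by rewrite /e; field.
(* For the upper bound, [f3 y - f3 x] is replaced by its largest value [d]. Integrating
   [t^2 * d / 12] twice then gives [t^4 * d / 144], with [144 = 12 * 3 * 4]. *)
set d := f3 (x + 1) - f3 x.
have e2_le y : x <= y <= x + 1 -> e2 y <= (y - x) ^+ 2 * (f3 y - f3 x) / 12.
  apply: (@derive_le R e2 e3 (fun y => (y - x) ^+ 2 * (f3 y - f3 x) / 12)
    (fun y => (y - x) * (f3 y - f3 x) / 6 + (y - x) ^+ 2 * f4 y / 12)
    x (x + 1)) => //.
  - move=> z hz; have ? := Df3 z hz.
    by apply: is_derive_eq; rewrite /GRing.scale/=; field.
  - move=> z hz; rewrite /e3 lerDr divr_ge0// mulr_ge0// subr_ge0 ?f3x//.
    by case/andP: hz.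
  - by rewrite e2x; lra.
have e1_le y : x <= y <= x + 1 -> e1 y <= (y - x) ^+ 3 * d / 36.
  apply: (@derive_le R e1 e2 (fun y => (y - x) ^+ 3 * d / 36)
    (fun y => (y - x) ^+ 2 * d / 12) x (x + 1)) => //.
  - move=> z hz.
    by apply: is_derive_eq; rewrite /GRing.scale/=; field.
  - move=> z hz; apply: (le_trans (e2_le z hz)).
    rewrite ler_pM2r ?invr_gt0// ler_wpM2l ?sqr_ge0// lerD2r f3x1//.
  - by rewrite e1x; lra.
have e_le y : x <= y <= x + 1 -> e y <= (y - x) ^+ 4 * d / 144.
  apply: (@derive_le R e e1 (fun y => (y - x) ^+ 4 * d / 144)
    (fun y => (y - x) ^+ 3 * d / 36) x (x + 1)) => //.
  - move=> z hz.
    by apply: is_derive_eq; rewrite /GRing.scale/=; field.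
  - by rewrite ex; lra.
rewrite e_ge0/= (le_trans (e_le _ xx))//.
by rewrite [x + 1]addrC addrK expr1n mul1r.
Qed.

(* A family closed under differentiation and integration; [c = (0, 1)] gives
   the terms of [zeta(k)] and [c = (1, 0)] those of [- zeta'(k)]. *)
Definition powln (R : realType) (k : nat) (c : R * R) (x : R) : R :=
  (c.1 * ln x + c.2) / x ^+ k.

Definition dpowln (R : realType) (k : nat) (c : R * R) : R * R :=
  (- (k%:R * c.1), c.1 - k%:R * c.2).

Lemma is_derive_powln (R : realType) (k : nat) (c : R * R) (x : R) : 0 < x ->
  is_derive x 1 (powln k c) (powln k.+1 (dpowln k c) x).
Proof.
move=> x0; have ? := is_derive1_ln x0.
have xk : x ^+ k != 0 by rewrite expf_neq0 ?gt_eqF.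
have dX : is_derive x 1 (fun y : R => y ^+ k) (k%:R * x ^+ k.-1).
  split; first exact: exprn_derivable.
  by rewrite exp_derive [LHS]mulr1.
have ? := @is_deriveV R (fun y : R => y ^+ k) x _ 1 xk dX.
apply: is_derive_eq; rewrite /powln /GRing.scale/=.
have [->|k0] := posnP k; first by rewrite !expr0 expr1; field; rewrite gt_eqF.
have E : x ^+ k = x * x ^+ k.-1 by rewrite -exprS prednK.
have : x ^+ k.-1 != 0 by rewrite expf_neq0 ?gt_eqF.
rewrite [x ^+ k.+1]exprS E; move: (x ^+ k.-1) => P P0.
by field; rewrite P0 gt_eqF.
Qed.

Definition powln_antideriv (R : realType) (k : nat) (c : R * R) : R * R :=
  (- c.1 / k%:R, (- c.1 / k%:R - c.2) / k%:R).

Lemma powln_antiderivK (R : realType) (k : nat) (c : R * R) : (0 < k)%N ->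
  dpowln k (powln_antideriv k c) = c.
Proof.
move=> k0; have kn0 : k%:R != 0 :> R by rewrite pnatr_eq0 -lt0n.
by rewrite [RHS]surjective_pairing /dpowln /=; congr pair; field.
Qed.

(* Euler-Maclaurin approximation, through the first derivative, of the sum of
   [powln k.+1 c n] over [n >= x]; it exceeds the sum by at most [em_err]. *)
Definition em_sum (R : realType) (k : nat) (c : R * R) (x : R) : R :=
  powln k.+1 c x / 2 - powln k (powln_antideriv k c) x
  - powln k.+2 (dpowln k.+1 c) x / 12.

Definition em_err (R : realType) (k : nat) (c : R * R) (x : R) : R :=
  - powln k.+4 (dpowln k.+3 (dpowln k.+2 (dpowln k.+1 c))) x / 144.

(** The function required to be nonnegative is the fourth derivative of the summand
    [powln k.+1 c]. *)
Definition em_ok (R : realType) (k : nat) (c : R * R) (N : nat) :=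
  forall x, N%:R <= x ->
    0 <= powln k.+4.+1 (dpowln k.+4 (dpowln k.+3 (dpowln k.+2 (dpowln k.+1 c)))) x.

(** The one-step estimate in telescoping form: the difference of [em_sum] at [n] and [n.+1], minus
    the term at [n], is exactly the error of the corrected trapezoidal rule on [[n, n + 1]]. *)
Lemma em_sum_step (R : realType) (k n : nat) (c : R * R) :
  (0 < k)%N -> (0 < n)%N -> em_ok k c n ->
  0 <= em_sum k c n%:R - em_sum k c n.+1%:R - powln k.+1 c n%:R
    <= em_err k c n%:R - em_err k c n.+1%:R.
Proof.
move=> k0 n0 p4.
have pos (y : R) : n%:R <= y <= n%:R + 1 -> 0 < y.
  by move=> /andP[+ _]; apply: lt_le_trans; rewrite ltr0n.
pose D k c y hy := @is_derive_powln R k c y (pos y hy).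
have D0 := D k (powln_antideriv k c); rewrite powln_antiderivK// in D0.
have := euler_maclaurin_step D0 (D _ _) (D _ _) (D _ _) (D _ _) _.
rewrite -[X in X + 1]/(1 *+ n) -mulrSr.
have H4 (y : R) : n%:R <= y <= n.+1%:R -> n%:R <= y by case/andP.
by move=> /(_ (fun y hy => p4 y (H4 y hy))); rewrite /em_sum /em_err; lra.
Qed.

Lemma em_sum_bounds (R : realType) (k N M : nat) (c : R * R) :
  (0 < k)%N -> (0 < N <= M)%N -> em_ok k c N ->
  0 <= em_sum k c N%:R - em_sum k c M%:R - \sum_(N <= n < M) powln k.+1 c n%:R
    <= em_err k c N%:R - em_err k c M%:R.
Proof.
move=> k0 /andP[N0]; elim: M => [|M IH]; first by rewrite leqNgt N0.
rewrite leq_eqVlt => /predU1P[<- _|NM p4]; first by rewrite big_geq// !subrr lexx.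
have := IH NM p4; have := @em_sum_step R k M c k0 (leq_trans N0 NM) _.
have -> : em_ok k c M = True.
  by rewrite propeqE; split => // _ x /(le_trans _) Mx; apply/p4/Mx; rewrite ler_nat.
by move=> /(_ Logic.I); rewrite big_nat_recr//=; lra.
Qed.

Lemma ln_le_sqrt (R : realType) (x : R) : 0 < x -> ln x <= 2 * Num.sqrt x.
Proof.
move=> x0; have s0 : 0 < Num.sqrt x by rewrite sqrtr_gt0.
have -> : ln x = 2 * ln (Num.sqrt x).
  by rewrite -[in LHS](sqr_sqrtr (ltW x0)) lnXn// mulr_natl.
by rewrite ler_wpM2l// ltW// ln_sublinear.
Qed.

Lemma cvg_ln_div (R : realType) : (fun n => ln (n%:R : R) / n%:R) @ \oo --> (0 : R).
Proof.
apply/cvgrPdist_le => e e0; near=> n.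
have n1 : 1 <= n%:R :> R by rewrite ler1n; near: n; exact: nbhs_infty_gt.
have n0 : 0 < n%:R :> R by apply: lt_le_trans n1.
have s0 : 0 < Num.sqrt n%:R :> R by rewrite sqrtr_gt0.
rewrite sub0r normrN ger0_norm ?divr_ge0 ?ln_ge0 ?(ltW n0)//.
rewrite ler_pdivrMr// (le_trans (ln_le_sqrt n0))//.
rewrite -[in leRHS](sqr_sqrtr (ltW n0)) expr2 mulrA ler_pM2r//.
rewrite -ler_pdivrMl// -(@ler_pXn2r _ 2%N)// ?nnegrE ?sqrtr_ge0//; last first.
  by rewrite mulr_ge0// invr_ge0 ltW.
rewrite sqr_sqrtr ?(ltW n0)//.
by near: n; exact: nbhs_infty_ger.
Unshelve. all: by end_near. Qed.

Lemma cvg_powln (R : realType) (k : nat) (c : R * R) :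
  (fun n => powln k.+1 c n%:R) @ \oo --> (0 : R).
Proof.
apply: norm_cvg0.
have h : (fun n => `|c.1| * (ln (n%:R : R) / n%:R) + `|c.2| * (n%:R)^-1) @ \oo --> (0 : R).
  rewrite -[X in _ --> X](_ : `|c.1| * 0 + `|c.2| * 0 = 0); last by rewrite !mulr0 addr0.
  apply: cvgD; apply: cvgMr; first exact: cvg_ln_div.
  rewrite -cvg_shiftS /=; exact: cvg_harmonic.
apply: (squeeze_cvgr _ (cvg_cst 0) h); near=> n.
have n1 : 1 <= n%:R :> R by rewrite ler1n; near: n; exact: nbhs_infty_gt.
have n0 : 0 < n%:R :> R by apply: lt_le_trans n1.
rewrite normr_ge0/= /powln normrM mulrA -mulrDl.
rewrite [`|_^-1|]ger0_norm ?invr_ge0 ?exprn_ge0 ?(ltW n0)//.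
apply: ler_pM => //.
  rewrite (le_trans (ler_normD _ _))// normrM [`|ln _|]ger0_norm// ln_ge0//.
by rewrite lef_pV2 ?posrE ?exprn_gt0// exprS ler_peMr ?(ltW n0)// exprn_ege1.
Unshelve. all: by end_near. Qed.

Lemma em_ok_inv (R : realType) (k N : nat) : (0 < N)%N ->
  em_ok k ((0, 1) : R * R) N.
Proof.
move=> N0 x Nx; have x0 : 0 < x by apply: lt_le_trans Nx; rewrite ltr0n.
rewrite /powln /dpowln /= divr_ge0 ?exprn_ge0 ?(ltW x0)//.
rewrite !(mulr0, mulr1, oppr0, mul0r, sub0r, add0r) !mulrN !opprK.
by rewrite !mulr_ge0.
Qed.

(** The fourth derivative of [ln x / x^(k+1)] has the sign of [ln x] minus the sum of [1/(k+i)] for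
    [i = 1, ..., 4]. That sum is at most [77/60] when [k >= 1], so the threshold [2] is ample. *)
Lemma em_ok_ln (R : realType) (k N : nat) : (0 < k)%N -> (0 < N)%N ->
  2 <= ln (N%:R : R) -> em_ok k ((1, 0) : R * R) N.
Proof.
move=> k0 N0 lnN x Nx.
have x0 : 0 < x by apply: lt_le_trans Nx; rewrite ltr0n.
rewrite /powln /dpowln /= divr_ge0 ?exprn_ge0 ?(ltW x0)//.
have lnx : 0 <= ln x - 2.
  by rewrite subr_ge0 (le_trans lnN)// ler_ln ?posrE// ltr0n.
have -> : k.+4%:R = k%:R + 4 :> R by rewrite -addn4 natrD.
have -> : k.+3%:R = k%:R + 3 :> R by rewrite -addn3 natrD.
have -> : k.+2%:R = k%:R + 2 :> R by rewrite -addn2 natrD.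
have -> : k.+1%:R = k%:R + 1 :> R by rewrite -addn1 natrD.
have k1 : 0 <= k%:R - 1 :> R by rewrite subr_ge0 ler1n.
move: (k%:R) k1 (ln x) lnx => K K1 L L2.
(* In the shifted variables [k - 1] and [ln x - 2] every coefficient of the numerator is
   nonnegative. *)
have -> : K = (K - 1) + 1 by ring.
have -> : L = (L - 2) + 2 by ring.
move: (K - 1) K1 (L - 2) L2 => {}K K0 {}L L0.
set e := (X in 0 <= X).
have -> : e = (K + 2) * (K + 3) * (K + 4) * (K + 5) * L
  + 2 * K ^+ 4 + 24 * K ^+ 3 + 100 * K ^+ 2 + 166 * K + 86.
  by rewrite /e; ring.
by rewrite !addr_ge0// ?mulr_ge0 ?addr_ge0 ?exprn_ge0.
Qed.

Lemma nondecreasing_series (R : realType) (f : nat -> R) :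
  (forall n, 0 <= f n) -> nondecreasing_seq (series f).
Proof.
move=> f0; apply/nondecreasing_seqP => n.
by rewrite /series/= big_nat_recr//= lerDl.
Qed.

(** Convergence and value come from the same estimate, since the boundary terms at [M] vanish as [M]
    grows. The exponent [k.+2] ensures that the antiderivative, of exponent [k.+1], also tends to
    [0]. *)
Lemma em_series (R : realType) (k N : nat) (c : R * R) (f := powln k.+2 c) :
  (0 < N)%N -> (forall n : nat, 0 <= f n%:R) -> em_ok k.+1 c N ->
  cvgn (series (fun n => f n%:R)) /\
  \sum_(0 <= n < N) f n%:R + em_sum k.+1 c N%:R - em_err k.+1 c N%:R <=
    limn (series (fun n => f n%:R)) <=
  \sum_(0 <= n < N) f n%:R + em_sum k.+1 c N%:R.
Proof.
move=> N0 f0 ok.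
have cvs : (fun n => em_sum k.+1 c n%:R) @ \oo --> (0 : R).
  have -> : 0 = 0 / 2 - 0 - 0 / 12 :> R by ring.
  apply: cvgB; [apply: cvgB|]; [apply: cvgMl| |apply: cvgMl]; exact: cvg_powln.
have cve : (fun n => em_err k.+1 c n%:R) @ \oo --> (0 : R).
  have -> : 0 = - 0 / 144 :> R by ring.
  by apply: cvgMl; apply: cvgN; exact: cvg_powln.
have bd M : (N <= M)%N ->
    0 <= em_sum k.+1 c N%:R - em_sum k.+1 c M%:R -
      (series (fun n => f n%:R) M - \sum_(0 <= n < N) f n%:R)
    <= em_err k.+1 c N%:R - em_err k.+1 c M%:R.
  move=> NM; rewrite /series /= (@big_cat_nat _ _ _ N 0 M)//=.
  rewrite [X in X - \sum_(0 <= n < N) _]addrC addrK.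
  by apply: em_sum_bounds; rewrite ?N0.
have nd := nondecreasing_series f0.
have cv : cvgn (series (fun n => f n%:R)).
  apply: nondecreasing_is_cvgn => //.
  exists (em_sum k.+1 c N%:R + 1 + \sum_(0 <= n < N) f n%:R) => _ [n _ <-].
  near \oo => M.
  have nM : (n <= M)%N by near: M; exact: nbhs_infty_ge.
  have NM : (N <= M)%N by near: M; exact: nbhs_infty_ge.
  (* The summand [1] in the proposed upper bound absorbs the boundary term at [M], which tends to
     [0]. *)
  have : - 1 <= em_sum k.+1 c M%:R.
    near: M; apply: (cvgr_ge _ cvs); lra.
  by have := bd M NM; have := nd _ _ nM; lra.
split => //.
have cv1 : (fun M => em_sum k.+1 c N%:R - em_sum k.+1 c M%:R -
      (series (fun n => f n%:R) M - \sum_(0 <= n < N) f n%:R)) @ \oo -->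
  em_sum k.+1 c N%:R - 0 -
      (limn (series (fun n => f n%:R)) - \sum_(0 <= n < N) f n%:R).
  by apply: cvgB; apply: cvgB => //; exact: cvg_cst.
have cv2 : (fun M => em_err k.+1 c N%:R - em_err k.+1 c M%:R -
  (em_sum k.+1 c N%:R - em_sum k.+1 c M%:R -
      (series (fun n => f n%:R) M - \sum_(0 <= n < N) f n%:R))) @ \oo -->
  em_err k.+1 c N%:R - 0 - (em_sum k.+1 c N%:R - 0 -
      (limn (series (fun n => f n%:R)) - \sum_(0 <= n < N) f n%:R)).
  by apply: cvgB => //; apply: cvgB => //; exact: cvg_cst.
have : 0 <= em_sum k.+1 c N%:R - 0 -
      (limn (series (fun n => f n%:R)) - \sum_(0 <= n < N) f n%:R).
  apply: (cvgr_to_ge cv1); near=> M.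
  have NM : (N <= M)%N by near: M; exact: nbhs_infty_ge.
  by case/andP: (bd M NM).
have : 0 <= em_err k.+1 c N%:R - 0 - (em_sum k.+1 c N%:R - 0 -
      (limn (series (fun n => f n%:R)) - \sum_(0 <= n < N) f n%:R)).
  apply: (cvgr_to_ge cv2); near=> M.
  have NM : (N <= M)%N by near: M; exact: nbhs_infty_ge.
  by case/andP: (bd M NM) => _; rewrite subr_ge0.
lra.
Unshelve. all: by end_near. Qed.

(** * Sums over primes as quotients of series over the integers *)

Lemma big_nat_multiples (R : realType) (p M : nat) (g : nat -> R) : (0 < p)%N ->
  (forall n, ~~ (p %| n)%N -> g n = 0) ->
  \sum_(0 <= n < p * M) g n = \sum_(0 <= n < M) g (p * n)%N.
Proof.
move=> p0 g0; elim: M => [|M IH]; first by rewrite muln0 !big_geq.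
rewrite mulnS addnC (@big_cat_nat _ _ _ (p * M)) ?leq_addr//= IH.
rewrite big_nat_recr//=; congr +%R.
rewrite -{1}[(p * M)%N]add0n big_addn addKn big_ltn// add0n.
rewrite big_nat big1 ?addr0// => i /andP[i0 ip].
by apply: g0; rewrite dvdn_addl ?dvdn_mulr// gtnNdvd.
Qed.

(** The range is a common bound [M] rather than [n.+1], so that the index set does not depend on [n]
    when the sums over [n] and [p] are exchanged. *)
Lemma ln_logn_sum (R : realType) (n M : nat) : (0 < n < M)%N ->
  ln (n%:R : R) = \sum_(0 <= p < M | prime p) (logn p n)%:R * ln p%:R.
Proof.
move=> /andP[n0 nM].
have {1}-> : n = (\prod_(0 <= p < M | prime p) p ^ logn p n)%N.
  rewrite -{1}[n]partnT// /partn (@big_nat_widen _ _ _ _ _ M)//=.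
  rewrite big_mkcond [RHS]big_mkcond/=.
  apply: eq_big_nat => p /andP[_ pM].
  case: (ltnP p n.+1) => pn; case: ifP => // pp; first by rewrite lognE pp.
  by rewrite lognE pp n0 /= gtnNdvd.
suff [] : (0 < \prod_(0 <= p < M | prime p) p ^ logn p n)%N /\
    ln (\prod_(0 <= p < M | prime p) p ^ logn p n)%:R =
    \sum_(0 <= p < M | prime p) (logn p n)%:R * ln (p%:R : R) by [].
apply: (big_rec2 (fun y x => (0 < y)%N /\ ln (y%:R : R) = x)).
  by rewrite ln1.
move=> p y x /prime_gt0 pp [y0 <-]; rewrite muln_gt0 expn_gt0 pp; split => //.
rewrite natrM natrX lnM ?posrE ?exprn_gt0 ?ltr0n// lnXn ?ltr0n//.
by rewrite mulr_natl.
Qed.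

Lemma cvg_sum_nat (R : realType) (P : pred nat) (N : nat) (f : nat -> nat -> R)
    (l : nat -> R) : (forall i, P i -> f i @ \oo --> l i) ->
  (fun M => \sum_(0 <= i < N | P i) f i M) @ \oo --> \sum_(0 <= i < N | P i) l i.
Proof.
move=> fl; elim: N => [|N IH].
  by under eq_fun do rewrite big_geq//; rewrite big_geq//; exact: cvg_cst.
have E g : \sum_(0 <= i < N.+1 | P i) g i =
    \sum_(0 <= i < N | P i) g i + (if P N then g N else 0) :> R.
  by rewrite big_mkcond big_nat_recr//= -big_mkcond.
under eq_fun do rewrite E.
rewrite E; apply: cvgD => //; case: ifP => [/fl//|_]; exact: cvg_cst.
Qed.

Definition logprime_term (R : realType) (k p : nat) : R :=
  if prime p then ln (p%:R : R) / (p%:R ^+ k - 1) else 0.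

(* With [z_M] the partial sums of [zeta(k)], the multiples of [p] contribute
   [A (p * M) = p^-k (z_M + A M)], whence the limit. *)
Lemma logn_series (R : realType) (k p : nat) (z : R) :
  (0 < k)%N -> prime p ->
  series (fun n => (n%:R : R) ^- k) @ \oo --> z ->
  let A := series (fun n => (logn p n)%:R * (n%:R : R) ^- k) in
  nondecreasing_seq A /\ A @ \oo --> z / (p%:R ^+ k - 1).
Proof.
move=> k0 pp cvz A.
have p0 := prime_gt0 pp.
have p1 : 1 < p%:R ^+ k :> R by rewrite exprn_egt1 ?ltr1n ?prime_gt1// -lt0n.
have pk0 : 0 < p%:R ^+ k - 1 :> R by rewrite subr_gt0.
have ik0 n : 0 <= (n%:R : R) ^- k by rewrite invr_ge0 exprn_ge0.
have ndA : nondecreasing_seq A.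
  by apply: nondecreasing_series => n; rewrite mulr_ge0.
have AE M : A (p * M)%N =
    p%:R ^- k * (series (fun n => (n%:R : R) ^- k) M + A M).
  rewrite /A /series /= big_nat_multiples//; last first.
    by move=> n /negbTE pn; rewrite lognE pn !andbF mul0r.
  rewrite -big_split /= mulr_sumr; apply: eq_bigr => -[|n] _.
    (* At [n = 0] both sides vanish: [k > 0] gives [0 ^+ k = 0], and the inverse of [0] is [0]. *)
    by rewrite muln0 expr0n gtn_eqF// invr0 !mulr0 addr0 mulr0.
  rewrite lognM// logn_prime// eqxx natrM exprMn invfM natrD /=.
  by ring.
have zM M : series (fun n => (n%:R : R) ^- k) M <= z.
  rewrite -(cvg_lim _ cvz)//; apply: nondecreasing_cvgn_le.
    exact: nondecreasing_series.
  by apply/cvg_ex; exists z.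
(* Monotonicity along [M <= p * M] bounds [A M] in terms of itself, and the factor [p^-k < 1] allows
   the inequality to be solved. *)
have AM M : A M <= z / (p%:R ^+ k - 1).
  have h : A M <= p%:R ^- k * (z + A M).
    apply: (@le_trans _ _ (A (p * M)%N)); first by rewrite ndA// leq_pmull.
    by rewrite AE ler_wpM2l// lerD2r.
  rewrite ler_pdivlMr//; move: h; rewrite mulrC ler_pdivlMr; last lra.
  lra.
split=> //.
have cvA : cvgn A.
  by apply: nondecreasing_is_cvgn => //; exists (z / (p%:R ^+ k - 1)) => _ [n _ <-].
have /cvg_ex[a Aa] : cvgn A by [].
have cv1 : (fun M => A (p * M)%N) @ \oo --> a.
  apply: (cvg_comp _ _ _ Aa); apply/cvgnyPge => n; near=> M.
  by rewrite (@leq_trans M)// ?leq_pmull//; near: M; exact: nbhs_infty_ge.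
have cv2 : (fun M => A (p * M)%N) @ \oo --> p%:R ^- k * (z + a).
  rewrite (_ : (fun M => _) = (fun M => p%:R ^- k *
     (series (fun n => (n%:R : R) ^- k) M + A M))); last by apply/funext.
  by apply: cvgMr; apply: cvgD.
have E : a = p%:R ^- k * (z + a) by apply: (cvg_unique _ cv1 cv2).
suff -> : z / (p%:R ^+ k - 1) = a by [].
have pn0 : p%:R ^+ k != 0 :> R by rewrite gt_eqF//; lra.
move/(congr1 ( *%R (p%:R ^+ k))): E; rewrite mulrA mulfV// mul1r => E.
have -> : z = a * (p%:R ^+ k - 1) by lra.
by rewrite mulfK ?gt_eqF.
Unshelve. all: by end_near. Qed.

(** Splitting [ln n] over primes and exchanging sums turns the partial sums of [Z] into sums of
    [ln p * A p M], where [A p M] increases to [z / (p^k - 1)]. Bounding each [A p M] by its limit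
    gives [Z_M <= S_M * z]. Fixing the primes below [P] and letting [M] grow gives [S_P * z <= Z].
    The partial sums [S_M] are thus squeezed between [Z_M / z] and [Z / z]. *)
Lemma cvg_logprime_series (R : realType) (k : nat) (z Z : R) : (0 < k)%N -> 0 < z ->
  series (fun n => (n%:R : R) ^- k) @ \oo --> z ->
  series (fun n => ln (n%:R : R) * n%:R ^- k) @ \oo --> Z ->
  series (@logprime_term R k) @ \oo --> Z / z.
Proof.
move=> k0 z0 cvz cvZ.
pose A p := series (fun n => (logn p n)%:R * (n%:R : R) ^- k).
have ZE M : series (fun n => ln (n%:R : R) * n%:R ^- k) M =
    \sum_(0 <= p < M | prime p) ln (p%:R : R) * A p M.
  rewrite /series /=.
  transitivity (\sum_(0 <= n < M) \sum_(0 <= p < M | prime p)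
     ln (p%:R : R) * ((logn p n)%:R * n%:R ^- k)).
    apply: eq_big_nat => -[|n] /andP[_ nM].
      rewrite expr0n gtn_eqF// invr0 mulr0 big1// => p _.
      by rewrite !mulr0.
    rewrite (@ln_logn_sum R n.+1 M)// mulr_suml; apply: eq_bigr => p _.
    by ring.
  rewrite exchange_big; apply: eq_bigr => p _.
  by rewrite /A /series /= mulr_sumr.
have SE M : series (@logprime_term R k) M * z =
    \sum_(0 <= p < M | prime p) ln (p%:R : R) * (z / (p%:R ^+ k - 1)).
  rewrite /series /logprime_term /= -big_mkcond mulr_suml/=.
  by apply: eq_bigr => p _; ring.
have lnp p : prime p -> 0 <= ln (p%:R : R).
  by move=> /prime_gt0 p0; rewrite ln_ge0// ler1n.
have up M : series (fun n => ln (n%:R : R) * n%:R ^- k) M <=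
    series (@logprime_term R k) M * z.
  rewrite ZE SE; apply: ler_sum => p pp; rewrite ler_wpM2l ?lnp//.
  have [nd cv] := logn_series k0 pp cvz.
  rewrite -(cvg_lim _ cv)//; apply: nondecreasing_cvgn_le => //.
  by apply/cvg_ex; eexists; exact: cv.
have lo P : series (@logprime_term R k) P * z <= Z.
  have cvP : (fun M => \sum_(0 <= p < P | prime p) ln (p%:R : R) * A p M) @ \oo
      --> series (@logprime_term R k) P * z.
    rewrite SE.
    apply: cvg_sum_nat => p pp; apply: cvgMr.
    by have [] := logn_series k0 pp cvz.
  apply: (ler_cvg_to cvP cvZ); near=> M.
  rewrite ZE [leRHS](@big_cat_nat _ _ _ P)//=; last by near: M; exact: nbhs_infty_ge.
  rewrite lerDl sumr_ge0// => p pp.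
  by rewrite mulr_ge0 ?lnp// sumr_ge0.
have cvu : (fun M => series (fun n => ln (n%:R : R) * n%:R ^- k) M / z) @ \oo --> Z / z.
  by apply: cvgMl.
apply: (squeeze_cvgr _ cvu (cvg_cst (Z / z))); near=> M.
by rewrite ler_pdivrMr// up ler_pdivlMr// lo.
Unshelve. all: by end_near. Qed.

(** * Interval arithmetic *)

HB.lock Definition fx (R : realType) (z : Z) : R := (int_of_Z z)%:~R.

Lemma fxD (R : realType) (a b : Z) : fx R (Z.add a b) = fx R a + fx R b.
Proof. by rewrite fx.unlock -intrD -raddfD. Qed.

Lemma fxB (R : realType) (a b : Z) : fx R (Z.sub a b) = fx R a - fx R b.
Proof. by rewrite fx.unlock -intrB -raddfB. Qed.

Lemma fxM (R : realType) (a b : Z) : fx R (Z.mul a b) = fx R a * fx R b.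
Proof. by rewrite fx.unlock -intrM -rmorphM. Qed.

Lemma fx_le (R : realType) (a b : Z) : Z.le a b -> fx R a <= fx R b.
Proof. by rewrite fx.unlock ler_int => h; lia. Qed.

Lemma fx_lt (R : realType) (a b : Z) : Z.lt a b -> fx R a < fx R b.
Proof. by rewrite fx.unlock ltr_int => h; lia. Qed.

Lemma fx0 (R : realType) : fx R 0 = 0.
Proof. by rewrite fx.unlock. Qed.

Lemma fx_nat (R : realType) (n : nat) : fx R (Z.of_nat n) = n%:R.
Proof. by rewrite fx.unlock; have -> : int_of_Z (Z.of_nat n) = n :> int by lia. Qed.

Lemma fx_gt0 (R : realType) (a : Z) : Z.lt 0 a -> 0 < fx R a.
Proof. by rewrite -(fx0 R); exact: fx_lt. Qed.

Definition fx_one : Z := Z.pow 2 64.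

Lemma fx_div_le (R : realType) (a b : Z) : Z.lt 0 b ->
  fx R (Z.div a b) * fx R b <= fx R a.
Proof.
by move=> b0; rewrite -fxM; apply: fx_le; rewrite Z.mul_comm; apply: Z.mul_div_le.
Qed.

Lemma fx_div_ge (R : realType) (a b : Z) : Z.lt 0 b ->
  fx R a <= fx R (Z.succ (Z.div a b)) * fx R b.
Proof.
move=> b0; rewrite -fxM; apply/fx_le/Z.lt_le_incl; rewrite Z.mul_comm.
exact: Z.mul_succ_div_gt.
Qed.

Lemma fx_max0 (R : realType) (z : Z) (t : R) : 0 <= t -> fx R z <= t ->
  0 <= fx R (Z.max 0 z) <= t.
Proof.
move=> t0 zt; apply/andP; split.
  by rewrite -{1}(fx0 R); apply: fx_le; exact: Z.le_max_l.
by case: (Z.max_spec 0 z) => -[_ ->]//; rewrite fx0.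
Qed.

(* Locked, lest unification unfold [2 ^ 64]. *)
HB.lock Definition scale (R : realType) : R := fx R fx_one.

Lemma scaleE (R : realType) : fx R fx_one = scale R.
Proof. by rewrite scale.unlock. Qed.

Lemma scale_gt0 (R : realType) : 0 < scale R.
Proof. by rewrite -scaleE; exact: fx_gt0. Qed.

Lemma fxMs (R : realType) (a : Z) : fx R (Z.mul a fx_one) = fx R a * scale R.
Proof. by rewrite fxM scaleE. Qed.

Definition rsh (z : Z) : Z := Z.shiftr z 64.
Arguments rsh : simpl never.

Lemma rshE (z : Z) : rsh z = Z.div z fx_one.
Proof. exact: Z.shiftr_div_pow2. Qed.

Definition itv := (Z * Z)%type.

Definition enc (R : realType) (i : itv) (x : R) : Prop :=
  fx R i.1 <= x * scale R /\ x * scale R <= fx R i.2.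

Definition iadd (i j : itv) : itv := (Z.add i.1 j.1, Z.add i.2 j.2).

Definition isub (i j : itv) : itv := (Z.sub i.1 j.2, Z.sub i.2 j.1).

(** Meant for nonnegative reals only. Their enclosures may still have a negative lower endpoint
    after rounding or subtraction, and two negative ones would multiply to a false lower bound,
    hence the clamping at [0]. The successor compensates the downward rounding of the shift. *)
Definition imul (i j : itv) : itv :=
  (rsh (Z.mul (Z.max 0 i.1) (Z.max 0 j.1)),
   Z.succ (rsh (Z.mul i.2 j.2))).

Definition iscale (n : Z) (i : itv) : itv := (Z.mul n i.1, Z.mul n i.2).

Definition idivz (i : itv) (n : Z) : itv :=
  (Z.div i.1 n, Z.succ (Z.div i.2 n)).

Definition iratio (a b : Z) : itv := idivz (Z.mul a fx_one, Z.mul a fx_one) b.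

Definition idiv (i j : itv) : itv :=
  (Z.div (Z.mul (Z.max 0 i.1) fx_one) j.2, Z.succ (Z.div (Z.mul i.2 fx_one) j.1)).

Lemma enc_add (R : realType) (i j : itv) (x y : R) :
  enc i x -> enc j y -> enc (iadd i j) (x + y).
Proof.
rewrite /enc /iadd; cbn [fst snd].
by rewrite !fxD mulrDl => -[? ?] [? ?]; split; exact: lerD.
Qed.

Lemma enc_sub (R : realType) (i j : itv) (x y : R) :
  enc i x -> enc j y -> enc (isub i j) (x - y).
Proof.
rewrite /enc /isub; cbn [fst snd].
by rewrite !fxB mulrBl => -[? ?] [? ?]; split; exact: lerB.
Qed.

Lemma enc_mul (R : realType) (i j : itv) (x y : R) : 0 <= x -> 0 <= y ->
  enc i x -> enc j y -> enc (imul i j) (x * y).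
Proof.
move=> x0 y0 [ix xi] [jy yj]; have S0 := scale_gt0 R.
rewrite /enc /imul; cbn [fst snd]; rewrite 2!rshE.
have /andP[a0 a1] := fx_max0 (mulr_ge0 x0 (ltW S0)) ix.
have /andP[b0 b1] := fx_max0 (mulr_ge0 y0 (ltW S0)) jy.
have E : x * y * scale R * scale R = (x * scale R) * (y * scale R) by ring.
split; rewrite -(ler_pM2r S0) E.
  rewrite -{1}scaleE; apply: (le_trans (fx_div_le _ _ _)) => //.
  by rewrite fxM ler_pM.
rewrite -[in leRHS]scaleE; apply: (le_trans _ (fx_div_ge _ _ _)) => //.
by rewrite fxM ler_pM// mulr_ge0// ltW.
Qed.

Lemma enc_scale (R : realType) (n : nat) (i : itv) (x : R) :
  enc i x -> enc (iscale (Z.of_nat n) i) (n%:R * x).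
Proof.
move=> [ix xi]; rewrite /enc /iscale; cbn [fst snd].
by rewrite 2!fxM fx_nat -mulrA; split; rewrite ler_wpM2l.
Qed.

Lemma enc_divz (R : realType) (i : itv) (n : Z) (x : R) : Z.lt 0 n ->
  enc i x -> enc (idivz i n) (x / fx R n).
Proof.
move=> n0 [ix xi]; rewrite /enc /idivz; cbn [fst snd].
have nr0 : 0 < fx R n by exact: fx_gt0.
rewrite mulrAC ler_pdivlMr// ler_pdivrMr//; split.
  exact: le_trans (fx_div_le _ _ n0) ix.
exact: le_trans xi (fx_div_ge _ _ n0).
Qed.

Lemma enc_div (R : realType) (i j : itv) (x y : R) : 0 <= x ->
  Z.lt 0 j.1 -> enc i x -> enc j y -> enc (idiv i j) (x / y).
Proof.
move=> x0 j0 [ix xi] [jy yj]; have S0 := scale_gt0 R.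
have j10 : 0 < fx R j.1 by exact: fx_gt0.
have y0 : 0 < y by rewrite -(pmulr_lgt0 _ S0) (lt_le_trans j10).
have j20 : 0 < fx R j.2 by rewrite (lt_le_trans j10)// (le_trans jy).
have j2 : Z.lt 0 j.2.
  by apply/Z.lt_nge => /(@fx_le R); rewrite fx0 leNgt j20.
have /andP[a0 a1] := fx_max0 (mulr_ge0 x0 (ltW S0)) ix.
rewrite /enc /idiv; cbn [fst snd]; rewrite mulrAC ler_pdivlMr// ler_pdivrMr//; split.
  set q := Z.div _ _; have [q0|q0] := lerP 0 (fx R q).
    apply: (@le_trans _ _ (fx R q * (fx R j.2 / scale R))).
      by rewrite ler_wpM2l// ler_pdivlMr.
    rewrite mulrA ler_pdivrMr//; apply: (le_trans (fx_div_le _ _ j2)).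
    by rewrite fxMs ler_pM2r.
  apply: (@le_trans _ _ 0); last by rewrite mulr_ge0// ltW.
  by rewrite nmulr_rle0// ltW.
set q := Z.succ _.
have xq : x * scale R * scale R <= fx R q * fx R j.1.
  apply: le_trans (fx_div_ge _ _ j0); by rewrite fxMs ler_pM2r.
have q0 : 0 <= fx R q.
  by rewrite -(pmulr_lge0 _ j10); apply: le_trans xq; rewrite !mulr_ge0// ltW.
rewrite -(ler_pM2r S0) (le_trans xq)// -mulrA ler_wpM2l//.
Qed.

Lemma enc_ratio (R : realType) (a b : Z) : Z.lt 0 b ->
  enc (iratio a b) (fx R a / fx R b).
Proof. by move=> b0; apply: enc_divz => //; rewrite /enc; cbn [fst snd]; rewrite fxMs. Qed.

Lemma enc_hull (R : realType) (i j : itv) (x y z : R) :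
  enc i x -> enc j y -> x <= z <= y -> enc (i.1, j.2) z.
Proof.
move=> [ix _] [_ yj] /andP[xz zy]; split; cbn [fst snd].
  by apply: (le_trans ix); rewrite ler_wpM2r// ltW// scale_gt0.
by apply: le_trans yj; rewrite ler_wpM2r// ltW// scale_gt0.
Qed.

(** * Enclosures of logarithms *)

Lemma is_derive_atanh_sum (R : realType) (J : nat) (t : R) : t ^+ 2 != 1 ->
  is_derive t 1 (fun y : R => \sum_(0 <= j < J) y ^+ j.*2.+1 / j.*2.+1%:R)
    ((1 - t ^+ J.*2) / (1 - t ^+ 2)).
Proof.
move=> t1; have t1' : 1 - t ^+ 2 != 0 by rewrite subr_eq0 eq_sym.
elim: J => [|J IH].
  under eq_fun do rewrite big_geq//.
  by rewrite expr0 subrr mul0r; exact: is_derive_cst.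
under eq_fun do rewrite big_nat_recr//=.
have dX : is_derive t 1 (fun y : R => y ^+ J.*2.+1) (J.*2.+1%:R * t ^+ J.*2).
  split; first exact: exprn_derivable.
  by rewrite exp_derive [LHS]mulr1.
have J0 : J.*2.+1%:R != 0 :> R by rewrite pnatr_eq0.
apply: is_derive_eq; rewrite /GRing.scale/= doubleS -[J.*2.+2]addn2 exprD.
move: J0; move: (J.*2.+1%:R) (t ^+ J.*2) => c T c0.
by field; rewrite c0 t1'.
Qed.

(** The middle term is [2 * atanh y], with derivative [2 / (1 - t^2)]. The truncated series has
    derivative [2 * (1 - t^(2J)) / (1 - t^2)], so the derivative of the remainder lies between [0]
    and [2 * t^(2J) / (1 - y^2)] for [0 <= t <= y]. *)
Lemma ln_atanh_bounds (R : realType) (J : nat) (y : R)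
    (p := 2 * \sum_(0 <= j < J) y ^+ j.*2.+1 / j.*2.+1%:R) : 0 <= y < 1 ->
  p <= ln (1 + y) - ln (1 - y) <=
    p + 2 * y ^+ J.*2.+1 / (J.*2.+1%:R * (1 - y ^+ 2)).
Proof.
move=> /andP[y0 y1].
have sq t : 0 <= t <= y -> t ^+ 2 <= y ^+ 2.
  by move=> /andP[t0 ty]; rewrite lerXn2r// nnegrE.
have sq1 : y ^+ 2 < 1 by rewrite expr_lt1.
pose S (t : R) := 2 * \sum_(0 <= j < J) t ^+ j.*2.+1 / j.*2.+1%:R.
pose l (t : R) := ln (1 + t) - ln (1 - t).
pose u (t : R) := S t + 2 * t ^+ J.*2.+1 / (J.*2.+1%:R * (1 - y ^+ 2)).
have dl t : 0 <= t <= y -> is_derive t 1 l (2 / (1 - t ^+ 2)).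
  move=> ht; have := sq t ht => t2.
  have p1 : 0 < 1 + t by lra.
  have p2 : 0 < 1 - t by lra.
  have d1 : is_derive t 1 (fun t => ln (1 + t)) ((1 + t)^-1 * 1).
    apply: (is_derive1_comp (f := @ln R) (g := fun t => 1 + t)).
      exact: is_derive1_ln.
    by apply: is_derive_eq; ring.
  have d2 : is_derive t 1 (fun t => ln (1 - t)) ((1 - t)^-1 * -1).
    apply: (is_derive1_comp (f := @ln R) (g := fun t => 1 - t)).
      exact: is_derive1_ln.
    by apply: is_derive_eq; ring.
  have p3 : 0 < 1 - t ^+ 2 by lra.
  by apply: is_derive_eq; field; rewrite !gt_eqF.
have dS t : 0 <= t <= y -> is_derive t 1 S (2 * ((1 - t ^+ J.*2) / (1 - t ^+ 2))).
  move=> /sq t2; have t21 : t ^+ 2 != 1 by rewrite lt_eqF// (le_lt_trans t2).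
  have := is_derive_atanh_sum J t21 => ?.
  by apply: is_derive_eq; rewrite /GRing.scale/=; lra.
have du t : 0 <= t <= y -> is_derive t 1 u (2 * ((1 - t ^+ J.*2) / (1 - t ^+ 2)) +
    2 * t ^+ J.*2 / (1 - y ^+ 2)).
  move=> ht; have := dS t ht => ?.
  have dX : is_derive t 1 (fun y : R => y ^+ J.*2.+1) (J.*2.+1%:R * t ^+ J.*2).
    split; first exact: exprn_derivable.
    by rewrite exp_derive [LHS]mulr1.
  have J0 : J.*2.+1%:R != 0 :> R by rewrite pnatr_eq0.
  apply: is_derive_eq; rewrite /GRing.scale/=.
  move: J0; move: (J.*2.+1%:R) => c c0.
  move: (_ / (1 - t ^+ 2)) => q.
  by field; rewrite c0/= gt_eqF// subr_gt0.
have S0 : S 0 = 0.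
  by rewrite /S big1 ?mulr0// => j _; rewrite expr0n mul0r.
have l0 : l 0 = 0 by rewrite /l addr0 subr0 subrr.
have u0 : u 0 = 0 by rewrite /u S0 expr0n mulr0 mul0r addr0.
apply/andP; split.
  apply: (@derive_le R S _ l _ 0 y dS dl) => [t ht||]; last 2 first.
  - by rewrite S0 l0.
  - by rewrite y0 lexx.
  have := sq t ht => t2; have [t0 _] := andP ht.
  rewrite ler_wpM2l// -[leRHS]mul1r ler_wpM2r// ?invr_ge0; first by lra.
  by rewrite lerBlDr lerDl exprn_ge0.
apply: (@derive_le R l _ u _ 0 y dl du) => [t ht||]; last 2 first.
- by rewrite u0 l0.
- by rewrite y0 lexx.
have := sq t ht => t2; have [t0 _] := andP ht.
have t1 : 0 < 1 - t ^+ 2 by lra.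
rewrite -subr_ge0.
have -> : 2 * ((1 - t ^+ J.*2) / (1 - t ^+ 2)) + 2 * t ^+ J.*2 / (1 - y ^+ 2)
   - 2 / (1 - t ^+ 2) = 2 * t ^+ J.*2 * ((1 - y ^+ 2)^-1 - (1 - t ^+ 2)^-1).
  by ring.
rewrite mulr_ge0// ?mulr_ge0 ?exprn_ge0// subr_ge0 lef_pV2 ?posrE//; lra.
Qed.

(** [T] carries the current odd power of [y]. The last power is returned with the partial sum
    because the remainder bound is a multiple of it. *)
Fixpoint atanh_itv (J i : nat) (T Y2 : itv) : itv * itv :=
  if J is J'.+1 then
    let r := atanh_itv J' i.+1 (imul T Y2) Y2 in
    (iadd (idivz T (Z.of_nat i.*2.+1)) r.1, r.2)
  else ((Z0, Z0), T).

Lemma enc0 (R : realType) : enc (Z0, Z0) (0 : R).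
Proof. by rewrite /enc; cbn [fst snd]; rewrite fx0 mul0r. Qed.

Lemma enc_atanh_itv (R : realType) (J i : nat) (T Y2 : itv) (y : R) : 0 <= y ->
  enc T (y ^+ i.*2.+1) -> enc Y2 (y ^+ 2) ->
  enc (atanh_itv J i T Y2).1 (\sum_(i <= j < i + J) y ^+ j.*2.+1 / j.*2.+1%:R)
  /\ enc (atanh_itv J i T Y2).2 (y ^+ (i + J).*2.+1).
Proof.
move=> y0; elim: J i T => [|J IH] i T eT eY.
  by rewrite addn0 big_geq//; split => //; exact: enc0.
have eT' : enc (imul T Y2) (y ^+ i.+1.*2.+1).
  by rewrite doubleS -addn2 exprD; apply: enc_mul; rewrite ?exprn_ge0.
have [e1 e2] := IH i.+1 _ eT' eY.
rewrite addnS -addSn; split=> //=.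
rewrite big_ltn ?addSn ?ltnS ?leq_addr//; apply: enc_add => //.
rewrite -(fx_nat R); apply: enc_divz => //; lia.
Qed.

(** With [y = 1 / (2n + 1)] one has [(1 + y) / (1 - y) = (n + 1) / n]. The added [3 * y^(2J+1)]
    covers the remainder of the series. *)
Definition dln_itv (J n : nat) : itv :=
  let Y := iratio 1 (Z.of_nat n.*2.+1) in
  let r := atanh_itv J 0 Y (imul Y Y) in
  (Z.mul 2 r.1.1, Z.add (Z.mul 2 r.1.2) (Z.mul 3 r.2.2)).

Lemma enc_dln_itv (R : realType) (J n : nat) : (0 < n)%N ->
  enc (dln_itv J n) (ln (n.+1%:R : R) - ln n%:R).
Proof.
move=> n0; pose y : R := (n.*2.+1%:R)^-1.
have d0 : 0 < n.*2.+1%:R :> R by rewrite ltr0n.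
have nE : n.*2.+1%:R = 2 * n%:R + 1 :> R.
  by rewrite -addn1 natrD -muln2 natrM mulrC.
have n0' : 1 <= n%:R :> R by rewrite ler1n.
have n1E : n.+1%:R = n%:R + 1 :> R by rewrite -addn1 natrD.
have y0 : 0 <= y by rewrite invr_ge0 ltW.
have y3 : y <= 3^-1 by rewrite lef_pV2 ?posrE// nE; lra.
have yy : 0 <= y < 1 by lra.
have lnE : ln (n.+1%:R : R) - ln n%:R = ln (1 + y) - ln (1 - y).
  rewrite -!ln_div ?posrE ?ltr0n//; try lra.
  congr ln; rewrite /y nE n1E; field.
  by rewrite !gt_eqF//; lra.
have eY : enc (iratio 1 (Z.of_nat n.*2.+1)) y.
  rewrite /y -(fx_nat R) -[_^-1]mul1r -[1](fx_nat R 1).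
  by apply: enc_ratio; lia.
have eY2 : enc (imul (iratio 1 (Z.of_nat n.*2.+1)) (iratio 1 (Z.of_nat n.*2.+1)))
    (y ^+ 2).
  by rewrite expr2; apply: enc_mul.
have [[l1 l2] [t1 t2]] := @enc_atanh_itv R J 0 _ _ y y0 eY eY2.
rewrite add0n in l1 l2 t1 t2.
have /andP[lo hi] := ln_atanh_bounds J yy.
rewrite lnE /dln_itv /enc; cbn zeta; cbn [fst snd].
have S0 := ltW (scale_gt0 R).
have two : fx R 2 = 2 by rewrite (fx_nat R 2).
have three : fx R 3 = 3 by rewrite (fx_nat R 3).
rewrite fxD !fxM two three.
set Q := \sum_(0 <= j < J) _ in l1 l2 lo hi.
(* Since [n >= 1] gives [y <= 1/3], the factor [2 / (1 - y^2)] is at most [9/4], hence below [3]. *)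
have rem : 2 * y ^+ J.*2.+1 / (J.*2.+1%:R * (1 - y ^+ 2)) <= 3 * y ^+ J.*2.+1.
  rewrite mulrAC ler_wpM2r ?exprn_ge0//.
  have yq : y ^+ 2 <= 3^-1 ^+ 2 by rewrite lerXn2r ?nnegrE ?invr_ge0.
  have J1 : 1 <= J.*2.+1%:R :> R by rewrite ler1n.
  by rewrite ler_pdivrMr; nra.
split.
  by rewrite (le_trans (ler_wpM2l _ l1))// mulrA ler_wpM2r.
apply: (@le_trans _ _ ((2 * Q + 3 * y ^+ J.*2.+1) * scale R)).
  by rewrite ler_wpM2r// (le_trans hi)// lerD2l.
by rewrite mulrDl -!mulrA lerD// ler_wpM2l.
Qed.

(* The series of [atanh (1 / (2 n + 1))] is cut off after a number of terms that
   leaves a remainder below [2 ^ -64]. *)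
Fixpoint ln_table (m n : nat) (L : itv) : seq (nat * itv) :=
  if m is m'.+1 then
    (n, L) :: ln_table m' n.+1 (iadd L (dln_itv (if (n < 16)%N then 22 else 7) n))
  else [::].

Definition sum_itv (F : nat -> itv -> itv) (t : seq (nat * itv)) : itv :=
  foldr (fun e i => iadd (F e.1 e.2) i) (Z0, Z0) t.

Lemma enc_sum_itv (R : realType) (F : nat -> itv -> itv) (f : nat -> R)
    (m n : nat) (L : itv) : (0 < n)%N -> enc L (ln (n%:R : R)) ->
  (forall i I, (0 < i)%N -> enc I (ln (i%:R : R)) -> enc (F i I) (f i)) ->
  enc (sum_itv F (ln_table m n L)) (\sum_(n <= i < n + m) f i).
Proof.
move=> + + HF; elim: m n L => [|m IH] n L n0 eL.
  by rewrite addn0 big_geq//; exact: enc0.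
rewrite addnS -addSn /= big_ltn ?addSn ?ltnS ?leq_addr//.
apply: enc_add; first exact: HF.
apply: IH => //.
have -> : ln (n.+1%:R : R) = ln n%:R + (ln n.+1%:R - ln n%:R) by ring.
by apply: enc_add => //; exact: enc_dln_itv.
Qed.

(** * Enclosures of [zeta(k)], of [- zeta'(k)] and of their quotients *)

Definition zpow (n k : nat) : Z := iter k (Z.mul (Z.of_nat n)) (Zpos xH).

Lemma fx_zpow (R : realType) (n k : nat) : fx R (zpow n k) = n%:R ^+ k.
Proof.
elim: k => [|k IH]; first by rewrite expr0 (fx_nat R 1).
by rewrite /zpow iterS fxM fx_nat IH exprS.
Qed.

Lemma zpow_gt0 (n k : nat) : (0 < n)%N -> Z.lt 0 (zpow n k).
Proof. by move=> n0; elim: k => //= k IH; apply: Z.mul_pos_pos => //; lia. Qed.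

Definition invpow_itv (k n : nat) (L : itv) : itv := iratio 1 (zpow n k).

Definition lninvpow_itv (k n : nat) (L : itv) : itv := imul L (invpow_itv k n L).

Lemma enc_invpow (R : realType) (k n : nat) (L : itv) : (0 < n)%N ->
  enc (invpow_itv k n L) ((n%:R : R) ^- k).
Proof.
move=> n0; rewrite -fx_zpow -[_^-1]mul1r -[1](fx_nat R 1).
exact/enc_ratio/zpow_gt0.
Qed.

Lemma enc_lninvpow (R : realType) (k n : nat) (L : itv) : (0 < n)%N ->
  enc L (ln (n%:R : R)) -> enc (lninvpow_itv k n L) (ln (n%:R : R) * n%:R ^- k).
Proof.
move=> n0 eL; apply: enc_mul => //; last exact: enc_invpow.
by rewrite ln_ge0// ler1n.
Qed.

Section em_itv.
Variables (N m : nat) (L : itv).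

Definition em_zeta_itv : itv :=
  iadd (iratio 1 (Z.mul 2 (zpow N m.+1)))
    (iadd (iratio 1 (Z.mul (Z.of_nat m) (zpow N m)))
          (iratio (Z.of_nat m.+1) (Z.mul 12 (zpow N m.+2)))).

Definition em_err_itv : itv :=
  iratio (Z.of_nat (m.+1 * m.+2 * m.+3)) (Z.mul 144 (zpow N m.+4)).

(** Arranged so that [ln N] enters through one product of nonnegative factors, as [imul] requires.
    The other two terms are the log-free parts of the antiderivative and of the first derivative. *)
Definition em_lnzeta_itv : itv :=
  isub (iadd (imul L em_zeta_itv)
             (iratio 1 (Z.mul (Z.of_nat (m * m)) (zpow N m))))
       (iratio 1 (Z.mul 12 (zpow N m.+2))).

Definition zeta_itv (t : seq (nat * itv)) : itv :=
  let u := iadd (sum_itv (invpow_itv m.+1) t) em_zeta_itv in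
  ((isub u em_err_itv).1, u.2).

Definition lnzeta_itv (t : seq (nat * itv)) : itv :=
  let u := iadd (sum_itv (lninvpow_itv m.+1) t) em_lnzeta_itv in
  ((isub u (imul L em_err_itv)).1, u.2).

Definition logprime_itv (t : seq (nat * itv)) : itv :=
  idiv (lnzeta_itv t) (zeta_itv t).

End em_itv.

Definition rest_itv (p : nat) (L : itv) : itv :=
  if prime p then
    imul L (iratio (Z.sub (Z.add (Z.sub (zpow p 5) (zpow p 2)) (Z.of_nat p)) 1)
      (Z.mul (Z.of_nat p) (Z.mul (Z.sub (zpow p 6) 1) (Z.sub (zpow p 5) 1))))
  else (Z0, Z0).

(* The index [m] of [logprime_itv] stands for the exponent [m + 1], so that
   [1, 2, 4, 5] yield [S_2, S_3, S_5, S_6]. *)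
Definition kappa_itv (N : nat) (LN : itv) : itv * itv :=
  let t := ln_table N.-1 1 (Z0, Z0) in
  let S m := logprime_itv N m LN t in
  let u := iadd (isub (iadd (iadd (S 1%N) (S 2%N)) (S 4%N)) (S 5%N))
    (sum_itv rest_itv t) in
  (u, iadd u (iratio 2 (Z.mul (zpow N 4) (Z.of_nat N.-1)))).

Lemma ln_nat_ge0 (R : realType) (n : nat) : 0 <= ln (n%:R : R).
Proof. by have [->|n0] := posnP n; [rewrite ln0 | rewrite ln_ge0// ler1n]. Qed.

Lemma enc_divM (R : realType) (a b : nat) (d : Z) (x : R) : (0 < b)%N ->
  0 < x -> fx R d = x -> enc (iratio (Z.of_nat a) (Z.mul (Z.of_nat b) d)) (a%:R / (b%:R * x)).
Proof.
move=> b0 x0 dx; rewrite -dx -!(fx_nat R) -fxM; apply: enc_ratio.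
apply: Z.mul_pos_pos; first by lia.
by apply/Z.lt_nge => /(@fx_le R); rewrite fx0 dx leNgt x0.
Qed.

Section em_itv_correct.
Variables (R : realType) (N m : nat) (L : itv).
Hypotheses (N0 : (0 < N)%N) (m0 : (0 < m)%N).

Let x0 : 0 < N%:R :> R. Proof. by rewrite ltr0n. Qed.

Let xk0 k : 0 < N%:R ^+ k :> R. Proof. by rewrite exprn_gt0. Qed.

Let m0' : 0 < m%:R :> R. Proof. by rewrite ltr0n. Qed.

Lemma em_sum_zetaE : em_sum m ((0, 1) : R * R) N%:R =
  1%:R / (2%:R * N%:R ^+ m.+1) +
    (1%:R / (m%:R * N%:R ^+ m) + m.+1%:R / (12%:R * N%:R ^+ m.+2)).
Proof.
rewrite /em_sum /powln /powln_antideriv /dpowln /= !exprS.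
by field; rewrite !gt_eqF.
Qed.

Lemma em_err_zetaE : em_err m ((0, 1) : R * R) N%:R =
  (m.+1 * m.+2 * m.+3)%:R / (144%:R * N%:R ^+ m.+4).
Proof.
rewrite /em_err /powln /dpowln /= !natrM.
by field; rewrite !gt_eqF.
Qed.

Lemma enc_em_zeta : enc (em_zeta_itv N m) (em_sum m ((0, 1) : R * R) N%:R).
Proof.
rewrite em_sum_zetaE; apply: enc_add; last apply: enc_add.
- exact: (@enc_divM R 1 2 _ _ isT (xk0 _) (fx_zpow R _ _)).
- exact: (@enc_divM R 1 m _ _ m0 (xk0 _) (fx_zpow R _ _)).
- exact: (@enc_divM R m.+1 12 _ _ isT (xk0 _) (fx_zpow R _ _)).
Qed.

Lemma enc_em_err : enc (em_err_itv N m) (em_err m ((0, 1) : R * R) N%:R).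
Proof.
rewrite em_err_zetaE.
exact: (@enc_divM R (m.+1 * m.+2 * m.+3) 144 _ _ isT (xk0 _) (fx_zpow R _ _)).
Qed.

Hypothesis eL : enc L (ln (N%:R : R)).

Let lnN0 : 0 <= ln (N%:R : R). Proof. by rewrite ln_ge0// ler1n. Qed.

Lemma enc_em_lnzeta : enc (em_lnzeta_itv N m L) (em_sum m ((1, 0) : R * R) N%:R).
Proof.
have -> : em_sum m ((1, 0) : R * R) N%:R =
   ln N%:R * em_sum m ((0, 1) : R * R) N%:R + 1%:R / ((m * m)%:R * N%:R ^+ m)
   - 1%:R / (12%:R * N%:R ^+ m.+2).
  rewrite /em_sum /powln /powln_antideriv /dpowln /= !exprS natrM.
  by field; rewrite !gt_eqF.
apply: enc_sub; first apply: enc_add.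
- apply: enc_mul => //; last exact: enc_em_zeta.
  by rewrite em_sum_zetaE !addr_ge0// divr_ge0// mulr_ge0// ltW.
- apply: (@enc_divM R 1 (m * m) _ _ _ (xk0 _) (fx_zpow R _ _)) => //.
  by rewrite muln_gt0 m0.
- exact: (@enc_divM R 1 12 _ _ isT (xk0 _) (fx_zpow R _ _)).
Qed.

(** The log-free part of the third derivative of [ln x / x^(m+1)] is positive and only lowers the
    error. Dropping it leaves [ln N] times the error for [zeta]. *)
Lemma em_err_lnzeta :
  em_err m ((1, 0) : R * R) N%:R <= ln N%:R * em_err m ((0, 1) : R * R) N%:R.
Proof.
rewrite /em_err /powln /dpowln /= -subr_ge0.
set e := (X in 0 <= X).
have -> : e = (m.+1%:R * m.+2%:R + m.+1%:R * m.+3%:R + m.+2%:R * m.+3%:R) /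
    (144 * N%:R ^+ m.+4).
  rewrite /e; field; by rewrite !gt_eqF.
by rewrite divr_ge0// ?mulr_ge0// !addr_ge0.
Qed.

Lemma powln_zetaE (k n : nat) : powln k ((0, 1) : R * R) n%:R = n%:R ^- k.
Proof. by rewrite /powln/= mul0r add0r mul1r. Qed.

Lemma powln_lnzetaE (k n : nat) :
  powln k ((1, 0) : R * R) n%:R = ln n%:R * n%:R ^- k.
Proof. by rewrite /powln/= mul1r addr0. Qed.

Lemma sum_from1 (f : nat -> R) : f 0 = 0 ->
  \sum_(0 <= n < N) f n = \sum_(1 <= n < 1 + N.-1) f n.
Proof. by move=> f0; rewrite big_ltn// f0 add0r add1n prednK. Qed.

Let t := ln_table N.-1 1 (Z0, Z0).

Let eln1 : enc (Z0, Z0) (ln (1%:R : R)).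
Proof. by rewrite ln1; exact: enc0. Qed.

Lemma zeta_itvP : exists2 z : R,
  series (fun n => (n%:R : R) ^- m.+1) @ \oo --> z & 1 <= z /\ enc (zeta_itv N m t) z.
Proof.
have f0 n : 0 <= powln m.+1 ((0, 1) : R * R) n%:R.
  by rewrite powln_zetaE invr_ge0 exprn_ge0.
have := @em_series R m.-1 N (0, 1).
rewrite prednK// => /(_ N0 f0 (@em_ok_inv R m N N0))[cv bd].
have E : (fun n => powln m.+1 ((0, 1) : R * R) n%:R) = (fun n => n%:R ^- m.+1).
  by apply/funext => n; rewrite powln_zetaE.
exists (limn (series (fun n => powln m.+1 ((0, 1) : R * R) n%:R))).
  by rewrite -E.
split.
  have : nondecreasing_seq (series (fun n => powln m.+1 ((0, 1) : R * R) n%:R)).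
    exact: nondecreasing_series.
  move=> /nondecreasing_cvgn_le/(_ cv 2%N); apply: le_trans.
  by rewrite E /series/= !big_nat_recr//= big_geq// expr0n invr0 !add0r expr1n invr1.
rewrite sum_from1 in bd; last by rewrite powln_zetaE expr0n invr0.
apply: (enc_hull _ _ bd); first apply: enc_sub; first 1 last.
- exact: enc_em_err.
- apply: enc_add; last exact: enc_em_zeta.
  apply: enc_sum_itv => // i I i0 eI; rewrite powln_zetaE.
  exact: enc_invpow.
- apply: enc_add; last exact: enc_em_zeta.
  apply: enc_sum_itv => // i I i0 eI; rewrite powln_zetaE.
  exact: enc_invpow.
Qed.

Hypothesis lnN2 : 2 <= ln (N%:R : R).

Lemma lnzeta_itvP : exists2 z : R,
  series (fun n => ln (n%:R : R) * n%:R ^- m.+1) @ \oo --> z &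
  0 <= z /\ enc (lnzeta_itv N m L t) z.
Proof.
have f0 n : 0 <= powln m.+1 ((1, 0) : R * R) n%:R.
  rewrite powln_lnzetaE mulr_ge0// ?invr_ge0 ?exprn_ge0//.
  exact: ln_nat_ge0.
have := @em_series R m.-1 N (1, 0).
rewrite prednK// => /(_ N0 f0 (@em_ok_ln R m N m0 N0 lnN2))[cv bd].
have E : (fun n => powln m.+1 ((1, 0) : R * R) n%:R) =
    (fun n => ln n%:R * n%:R ^- m.+1).
  by apply/funext => n; rewrite powln_lnzetaE.
exists (limn (series (fun n => powln m.+1 ((1, 0) : R * R) n%:R))).
  by rewrite -E.
split.
  apply: limr_ge => //; near=> n; exact: sumr_ge0.
rewrite sum_from1 in bd; last by rewrite powln_lnzetaE expr0n invr0 mulr0.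
set S := \sum_(_ <= _ < _) _ in bd.
have bd' : S + em_sum m (1, 0) N%:R - ln N%:R * em_err m (0, 1) N%:R <=
    limn (series (fun n => powln m.+1 ((1, 0) : R * R) n%:R)) <=
    S + em_sum m (1, 0) N%:R.
  have := em_err_lnzeta; lra.
have eS : enc (iadd (sum_itv (lninvpow_itv m.+1) t) (em_lnzeta_itv N m L))
    (S + em_sum m (1, 0) N%:R).
  apply: enc_add; last exact: enc_em_lnzeta.
  apply: enc_sum_itv => // i I i0 eI; rewrite powln_lnzetaE.
  exact: enc_lninvpow.
apply: (enc_hull _ eS bd'); apply: enc_sub => //.
apply: enc_mul => //; last exact: enc_em_err.
by rewrite em_err_zetaE divr_ge0// mulr_ge0// ltW.
Unshelve. all: by end_near. Qed.

Lemma logprime_itvP : Z.lt 0 (zeta_itv N m t).1 -> exists2 S : R,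
  series (@logprime_term R m.+1) @ \oo --> S & enc (logprime_itv N m L t) S.
Proof.
move=> zp; have [z cz [z1 ez]] := zeta_itvP; have [Z cZ [Z0 eZ]] := lnzeta_itvP.
exists (Z / z); last exact: enc_div.
by apply: cvg_logprime_series => //; rewrite (lt_le_trans ltr01).
Qed.

End em_itv_correct.

(** * Decomposition and numerical value of [kappa] *)

Definition rest_term (R : realType) (p : nat) : R :=
  if prime p then ln p%:R * ((p%:R ^+ 5 - p%:R ^+ 2 + p%:R - 1) /
    (p%:R * ((p%:R ^+ 6 - 1) * (p%:R ^+ 5 - 1)))) else 0.

(** An identity of rational functions in [p]. In [rest_term] the difference is brought over a single
    denominator, where its sign and its order [p^-7] can be read off. *)
Lemma kappa_termE (R : realType) (p : nat) : kappa_term R p =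
  logprime_term R 2 p + logprime_term R 3 p + logprime_term R 5 p
  - logprime_term R 6 p + rest_term R p.
Proof.
rewrite /kappa_term /logprime_term /rest_term; case: ifP => [pp|]; last by rewrite !addr0 subrr.
have p1 : 1 < p%:R :> R by rewrite ltr1n prime_gt1.
move: (p%:R : R) p1 (ln _) => x x1 l.
have xk k : x ^+ k.+1 - 1 != 0 by rewrite subr_eq0 gt_eqF// exprn_egt1.
by field; rewrite !xk subr_eq0 !gt_eqF// (lt_trans ltr01).
Qed.

(** For a prime [x = p.+1], one power of [x] absorbs [ln x], and [x^6 >= 2] turns [1 / (x^6 - 1)]
    into at most [2 / x^6]. Giving up [x^4 >= N^4] leaves [1 / (x (x - 1))], which telescopes. *)
Lemma rest_term_bounds (R : realType) (N p : nat) : (0 < p)%N ->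
  (0 < N <= p.+1)%N ->
  0 <= rest_term R p.+1 <= 2 / N%:R ^+ 4 * (p%:R^-1 - p.+1%:R^-1).
Proof.
move=> p_gt0 /andP[N0 Np].
have N0' : 0 < N%:R :> R by rewrite ltr0n.
have p0 : 0 < p%:R :> R by rewrite ltr0n.
have p1E : p.+1%:R = p%:R + 1 :> R by rewrite -addn1 natrD.
rewrite /rest_term; case: ifP => pp; last first.
  by rewrite lexx mulr_ge0// ?divr_ge0 ?exprn_ge0 ?(ltW N0')// subr_ge0 lef_pV2 ?posrE ?p1E; lra.
have x2 : 2 <= p.+1%:R :> R by rewrite ler_nat prime_gt1.
have l0 := ln_nat_ge0 R p.+1.
have lx : ln (p.+1%:R : R) <= p.+1%:R by rewrite ltW// ln_sublinear// ltr0n.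
have -> : p%:R^-1 - p.+1%:R^-1 = (p%:R * (p%:R + 1))^-1 :> R.
  by rewrite p1E; field; rewrite gt_eqF//= gt_eqF//; lra.
have pE : p%:R = p.+1%:R - 1 :> R by rewrite p1E; ring.
have xN : N%:R <= p.+1%:R :> R by rewrite ler_nat.
move: (p.+1%:R : R) x2 l0 lx pE xN => x x2; move: (ln x) => l l0 lx pE xN.
rewrite pE; move: {p p_gt0 N0 Np pp p0 p1E pE} (N%:R) N0' xN => n n0 nx.
have xk k : 0 < x ^+ k.+1 - 1 by rewrite subr_gt0 exprn_egt1//; lra.
have sq : x <= x ^+ 2 by rewrite expr2; nra.
have x56 : x ^+ 2 <= x ^+ 5 by rewrite ler_eXn2l//; lra.
have x6 : 2 <= x ^+ 6 by have := xk 0; rewrite expr1 !exprS; nra.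
have -> : l * ((x ^+ 5 - x ^+ 2 + x - 1) / (x * ((x ^+ 6 - 1) * (x ^+ 5 - 1)))) =
    (l / x) * ((x ^+ 5 - x ^+ 2 + x - 1) / (x ^+ 5 - 1)) / (x ^+ 6 - 1).
  by field; rewrite !gt_eqF//; lra.
have lx1 : 0 <= l / x <= 1.
  by rewrite divr_ge0 ?ler_pdivrMr ?mul1r//; lra.
have q1 : 0 <= (x ^+ 5 - x ^+ 2 + x - 1) / (x ^+ 5 - 1) <= 1.
  by rewrite divr_ge0 ?ler_pdivrMr ?mul1r ?(ltW (xk _))//; lra.
move: (l / x) lx1 ((x ^+ 5 - x ^+ 2 + x - 1) / (x ^+ 5 - 1)) q1 => a /andP[a0 a1] b /andP[b0 b1].
rewrite divr_ge0 ?mulr_ge0 ?(ltW (xk _))//=.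
apply: (@le_trans _ _ (2 / x ^+ 6)).
  rewrite ler_pdivrMr// mulrAC ler_pdivlMr ?exprn_gt0//; last lra.
  have : a * b <= 1 by rewrite mulr_ile1.
  nra.
have -> : x - 1 + 1 = x by ring.
rewrite -mulrA ler_wpM2l// -invfM lef_pV2 ?posrE ?mulr_gt0 ?exprn_gt0//; try lra.
rewrite (_ : 6 = 4 + 2)%N// exprD ler_pM ?mulr_ge0 ?exprn_ge0 ?ler_pXn2r ?nnegrE ?(ltW n0)//; try lra.
Qed.

Lemma kappa_decomposition (R : realType) (N : nat) (S2 S3 S5 S6 : R) : (1 < N)%N ->
  series (@logprime_term R 2) @ \oo --> S2 ->
  series (@logprime_term R 3) @ \oo --> S3 ->
  series (@logprime_term R 5) @ \oo --> S5 ->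
  series (@logprime_term R 6) @ \oo --> S6 ->
  let V := S2 + S3 + S5 - S6 + \sum_(0 <= p < N) rest_term R p in
  series (kappa_term R) @ \oo --> kappa R /\
  V <= kappa R <= V + 2 / (N%:R ^+ 4 * N.-1%:R).
Proof.
move=> N1 c2 c3 c5 c6 V.
have N10 : (0 < N.-1)%N by lia.
have r0 p : 0 <= rest_term R p.
  case: p => [|[|p]]; [by rewrite /rest_term..|].
  by have /andP[] := @rest_term_bounds R 1 p.+1 isT isT.
have bd M : (N <= M)%N -> \sum_(N <= p < M) rest_term R p <=
    2 / N%:R ^+ 4 * (N.-1%:R^-1 - M.-1%:R^-1).
  move=> NM; rewrite -(subnKC NM); elim: (M - N)%N => [|k IH].
    by rewrite addn0 big_geq// subrr mulr0.
  rewrite addnS big_nat_recr ?leq_addr//= (le_trans (lerD IH (lexx _)))//.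
  have Nk0 : (0 < (N + k).-1)%N by lia.
  have := @rest_term_bounds R N (N + k).-1 Nk0.
  have -> : (N + k).-1.+1 = (N + k)%N by lia.
  rewrite leq_addr (ltnW N1) => /(_ isT)/andP[_ h].
  by apply: (le_trans (lerD (lexx _) h)); rewrite -mulrDr ler_wpM2l ?divr_ge0//; lra.
have ndr := nondecreasing_series r0.
have N40 : 0 < N%:R ^+ 4 :> R by rewrite exprn_gt0// ltr0n (ltnW N1).
have N1'0 : 0 < N.-1%:R :> R by rewrite ltr0n.
have up M : series (rest_term R) M <=
    \sum_(0 <= p < N) rest_term R p + 2 / (N%:R ^+ 4 * N.-1%:R).
  have [MN|NM] := leqP M N.
    by apply: (le_trans (ndr _ _ MN)); rewrite lerDl divr_ge0// mulr_ge0// ltW.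
  rewrite /series /= (@big_cat_nat _ _ _ N)//=; last exact: ltnW.
  rewrite lerD2l (le_trans (bd _ (ltnW NM)))//.
  rewrite [in leRHS]invfM [leRHS]mulrA ler_wpM2l ?divr_ge0 ?(ltW N40)//.
  by rewrite lerBlDr lerDl invr_ge0.
have cr : cvgn (series (rest_term R)).
  by apply: nondecreasing_is_cvgn => //; eexists => _ [n _ <-]; exact: up.
have E : series (kappa_term R) = (fun M => series (@logprime_term R 2) M +
  series (@logprime_term R 3) M + series (@logprime_term R 5) M -
  series (@logprime_term R 6) M + series (rest_term R) M).
  apply/funext => M; rewrite /series/= -!big_split/= -sumrB -big_split/=.
  by apply: eq_bigr => p _; exact: kappa_termE.
have ck : series (kappa_term R) @ \oo -->
    S2 + S3 + S5 - S6 + limn (series (rest_term R)).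
  by rewrite E; apply: cvgD => //; apply: cvgB => //; apply: cvgD => //; exact: cvgD.
have kE : kappa R = S2 + S3 + S5 - S6 + limn (series (rest_term R)).
  exact: cvg_lim ck.
have lo : series (rest_term R) N <= limn (series (rest_term R)).
  exact: nondecreasing_cvgn_le.
have hi : limn (series (rest_term R)) <=
    series (rest_term R) N + 2 / (N%:R ^+ 4 * N.-1%:R).
  by apply: limr_le => //; near=> n; exact: up.
rewrite kE; split => //; rewrite /V.
have sE : series (rest_term R) N = \sum_(0 <= p < N) rest_term R p by [].
by rewrite sE in lo hi; lra.
Unshelve. all: by end_near. Qed.

Lemma enc_rest (R : realType) (p : nat) (L : itv) : (0 < p)%N ->
  enc L (ln (p%:R : R)) -> enc (rest_itv p L) (rest_term R p).
Proof.
move=> p0 eL; rewrite /rest_itv /rest_term; case: ifP => pp; last exact: enc0.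
have p2 : 2 <= p%:R :> R by rewrite ler_nat prime_gt1.
have xk k : 0 < p%:R ^+ k.+1 - 1 :> R by rewrite subr_gt0 exprn_egt1//; lra.
have sq : p%:R ^+ 2 <= p%:R ^+ 5 :> R by rewrite ler_eXn2l//; lra.
apply: enc_mul => //; first exact: ln_nat_ge0.
  by rewrite divr_ge0 ?mulr_ge0 ?(ltW (xk _))//; lra.
set d := Z.mul _ _.
have dE : fx R d = p%:R * ((p%:R ^+ 6 - 1) * (p%:R ^+ 5 - 1)).
  by rewrite !fxM !fxB !fx_zpow fx_nat (fx_nat R 1).
have d0 : 0 < fx R d by rewrite dE !mulr_gt0//; lra.
have -> : p%:R ^+ 5 - p%:R ^+ 2 + p%:R - 1 =
  fx R (Z.sub (Z.add (Z.sub (zpow p 5) (zpow p 2)) (Z.of_nat p)) 1).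
  by rewrite fxB fxD fxB !fx_zpow fx_nat (fx_nat R 1).
rewrite -dE; apply: enc_ratio.
by apply/Z.lt_nge => /(@fx_le R); rewrite fx0 leNgt d0.
Qed.

Lemma kappa_itvP (R : realType) (N : nat) (L : itv) (t := ln_table N.-1 1 (Z0, Z0)) :
  (1 < N)%N -> enc L (ln (N%:R : R)) -> 2 <= ln (N%:R : R) ->
  (forall m, m \in [:: 1; 2; 4; 5]%N -> Z.lt 0 (zeta_itv N m t).1) ->
  series (kappa_term R) @ \oo --> kappa R /\
  enc ((kappa_itv N L).1.1, (kappa_itv N L).2.2) (kappa R).
Proof.
move=> N1 eL lnN zp; have N0 := ltnW N1.
have [S2 c2 e2] := @logprime_itvP R N 1 L N0 isT eL lnN (zp 1%N isT).
have [S3 c3 e3] := @logprime_itvP R N 2 L N0 isT eL lnN (zp 2%N isT).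
have [S5 c5 e5] := @logprime_itvP R N 4 L N0 isT eL lnN (zp 4%N isT).
have [S6 c6 e6] := @logprime_itvP R N 5 L N0 isT eL lnN (zp 5%N isT).
have [ck bd] := kappa_decomposition N1 c2 c3 c5 c6.
split => //.
have e : enc (kappa_itv N L).1
    (S2 + S3 + S5 - S6 + \sum_(0 <= p < N) rest_term R p).
  apply: enc_add.
    by apply: enc_sub => //; apply: enc_add => //; exact: enc_add.
  rewrite sum_from1//; apply: enc_sum_itv => //; first by rewrite ln1; exact: enc0.
  by move=> i I i0 eI; exact: enc_rest.
apply: (enc_hull e _ bd); apply: enc_add => //.
set d := Z.mul _ _.
have dE : fx R d = N%:R ^+ 4 * N.-1%:R by rewrite fxM fx_zpow fx_nat.
have d0 : 0 < fx R d.
  by rewrite dE mulr_gt0 ?exprn_gt0 ?ltr0n//; lia.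
rewrite -dE -[2 in X in enc _ X](fx_nat R 2); apply: enc_ratio.
by apply/Z.lt_nge => /(@fx_le R); rewrite fx0 leNgt d0.
Qed.

(** The integer 75536661083, grouped like the numerator of [kappa_approx] so that the two match term
    by term and the unary numerals stay small. *)
Definition kappa_num : Z :=
  Z.add (Z.add (Z.add (Z.mul (Z.of_nat 755) (zpow 10 8))
    (Z.mul (Z.of_nat 366) (zpow 10 5))) (Z.mul (Z.of_nat 610) (zpow 10 2)))
    (Z.of_nat 83).

(** Both bounds, [a / b] from below and [(a + 1) / b] from above, are cleared of the denominators
    [b] and [2^64], leaving integer comparisons. The first conjunct makes the divisions by the
    enclosures of [zeta] legitimate. *)
Definition kappa_check (N : nat) (L : itv) (a b : Z) : bool :=
  let t := ln_table N.-1 1 (Z0, Z0) in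
  let k := kappa_itv N L in
  [&& all (fun m => Z.ltb 0 (zeta_itv N m t).1) [:: 1; 2; 4; 5]%N,
    Z.leb (Z.mul a fx_one) (Z.mul k.1.1 b) &
    Z.ltb (Z.mul k.2.2 b) (Z.mul (Z.succ a) fx_one)].

Lemma kappa_approxE (R : realType) : kappa_approx R = fx R kappa_num / 10%:R ^+ 11.
Proof.
have aM a k : fx R (Z.mul (Z.of_nat a) (zpow 10 k)) = a%:R * 10%:R ^+ k.
  by rewrite fxM fx_nat fx_zpow.
by rewrite /kappa_num 3!fxD 3!aM fx_nat.
Qed.

Lemma kappa_checkP (R : realType) (N : nat) (L : itv) (a b : Z) :
  (1 < N)%N -> enc L (ln (N%:R : R)) -> 2 <= ln (N%:R : R) -> Z.lt 0 b ->
  kappa_check N L a b ->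
  series (kappa_term R) @ \oo --> kappa R /\
  fx R a / fx R b <= kappa R < fx R a / fx R b + (fx R b)^-1.
Proof.
move=> N1 eL lnN b0 /and3P[/allP zp lo hi].
have {}zp m : m \in [:: 1; 2; 4; 5]%N ->
    Z.lt 0 (zeta_itv N m (ln_table N.-1 1 (Z0, Z0))).1.
  by move=> /zp /Z.ltb_lt.
have [ck [klo khi]] := kappa_itvP N1 eL lnN zp.
move: (kappa_itv N L) lo hi klo khi => k lo hi klo khi.
split => //.
have B0 : 0 < fx R b by exact: fx_gt0.
have S0 := scale_gt0 R.
have {}lo : fx R a * scale R <= fx R k.1.1 * fx R b.
  by rewrite -fxMs -fxM; apply/fx_le/Z.leb_le.
have {}hi : fx R k.2.2 * fx R b < (fx R a + 1) * scale R.
  rewrite -[1](fx_nat R 1) -fxD -fxMs -fxM; exact/fx_lt/Z.ltb_lt.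
apply/andP; split.
  rewrite ler_pdivrMr// -(ler_pM2r S0) (le_trans lo)// mulrAC ler_pM2r//.
have -> : fx R a / fx R b + (fx R b)^-1 = (fx R a + 1) / fx R b.
  by rewrite mulrDl mul1r.
rewrite ltr_pdivlMr// -(ltr_pM2r S0).
by apply: le_lt_trans hi; rewrite mulrAC ler_pM2r.
Qed.

(** The choice [N = 256] makes [ln N = 8 * ln 2] available from one logarithm. The bound for the
    tail of the remainder, [2 / (256^4 * 255)], is then below [2 * 10^-12], and each Euler-Maclaurin
    error is below [10^-12], against a window of width [10^-11]. *)
Lemma kappa_check256 :
  kappa_check 256 (iscale 8 (dln_itv 22 1)) kappa_num (zpow 10 11).
Proof. by vm_compute. Qed.

Lemma kappa_value (R : realType) :
  series (kappa_term R) @ \oo --> kappa R /\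
  kappa_approx R <= kappa R < kappa_approx R + (10%:R ^+ 11)^-1.
Proof.
have ln256 : ln (256%:R : R) = 8%:R * (ln 2%:R - ln 1%:R).
  by rewrite ln1 subr0 mulr_natl -lnXn ?ltr0n// -natrX.
have eL : enc (iscale 8 (dln_itv 22 1)) (ln (256%:R : R)).
  rewrite ln256; apply: (@enc_scale R 8); exact: enc_dln_itv.
have ln2 : 2^-1 <= ln (2%:R : R).
  have := @le_ln1Dx R (- 2^-1); rewrite (_ : 1 - 2^-1 = 2^-1 :> R); last by field.
  by rewrite lnV ?posrE//; lra.
have lnN : 2 <= ln (256%:R : R) by rewrite ln256 ln1; lra.
rewrite kappa_approxE -(fx_zpow R 10 11).
exact: (@kappa_checkP R 256 _ _ _ isT eL lnN (@zpow_gt0 10 11 isT) kappa_check256).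
Qed.

(** * The quantities [mu_p], [w_y(x)] and [kappa_m] *)

Lemma mu_le (m p j : nat) : (j <= m)%N -> (mu m p <= j %/ p + (m - j) %/ p)%N.
Proof.
move=> jm; rewrite /mu.
have : @Ordinal m.+1 j jm \in index_enum 'I_m.+1 by rewrite mem_index_enum.
elim: (index_enum _) => // i r IH; rewrite inE big_cons => /predU1P[<-|/IH].
  exact: geq_minl.
by apply: leq_trans; exact: geq_minr.
Qed.

(** For the lower bound, write [j = a p + b] and [m - j = c p + d] with remainders at most [p - 1].
    Then [m + 1 <= (a + c) p + 2 p - 1], so [floor((m+1)/p) <= a + c + 1]. *)
Lemma muE (m p : nat) : (0 < p <= m.+1)%N -> mu m p = ((m + 1) %/ p - 1)%N.
Proof.
move=> /andP[p0 pm]; rewrite addn1; apply/eqP; rewrite eqn_leq; apply/andP; split.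
  have pm' : (p.-1 <= m)%N by rewrite -ltnS prednK.
  have := mu_le p pm'; rewrite divn_small ?prednK// add0n.
  have -> : (m - p.-1 = m.+1 - p)%N by rewrite -[in RHS](prednK p0) subSS.
  by rewrite -[X in ((_ - X) %/ _)%N]mul1n divnBMl.
rewrite /mu; apply: (big_ind (fun x => m.+1 %/ p - 1 <= x)%N) => [|x y hx hy|i _].
- rewrite leq_subLR add1n; exact: leq_div.
- by rewrite leq_min hx.
- have im : (i <= m)%N by rewrite -ltnS.
  have := divn_eq i p; have := divn_eq (m - i) p.
  have := ltn_pmod i p0; have := ltn_pmod (m - i) p0.
  have := divn_eq m.+1 p.
  move: (i %/ p)%N (i %% p)%N ((m - i) %/ p)%N ((m - i) %% p)%N (m.+1 %/ p)%N (m.+1 %% p)%N => a b c d e f.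
  nia.
Qed.

(** As [ln x >= 1], one gets [ln y = ln x + ln (y/x) <= ln x + (y/x - 1) <= (y/x) * ln x]. *)
Lemma ln_div_antitone (R : realType) (x y : R) : 0 < x -> 1 <= ln x -> x <= y ->
  ln y / y <= ln x / x.
Proof.
move=> x0 l1 xy; have y0 : 0 < y by rewrite (lt_le_trans x0).
rewrite ler_pdivrMr// mulrAC -mulrA -ler_pdivrMl; last by rewrite (lt_le_trans ltr01).
have yx : 1 <= y / x by rewrite ler_pdivlMr// mul1r.
have : ln (y / x) <= y / x - 1.
  by have := @le_ln1Dx R (y / x - 1); rewrite [1 + _]addrC subrK; apply; lra.
rewrite ln_div// => h.
by rewrite mulrC ler_pdivrMr; [nra|lra].
Qed.

(** Two uses of [ln (1 + t) <= t] suffice: [(x - 1) (ln y - ln x) <= (x - 1) (y - x) / x = (y - x)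
    (1 - 1/x) <= (y - x) ln x], which rearranges to the claim. *)
Lemma sub1_div_ln_homo (R : realType) (x y : R) : 1 < x -> x <= y ->
  (x - 1) / ln x <= (y - 1) / ln y.
Proof.
move=> x1 xy; have x0 : 0 < x by lra. have y0 : 0 < y by lra.
have lx0 : 0 < ln x by rewrite ln_gt0.
have ly0 : 0 < ln y by rewrite ln_gt0//; lra.
have h1 : ln y - ln x <= y / x - 1.
  rewrite -ln_div//; have := @le_ln1Dx R (y / x - 1).
  rewrite [1 + _]addrC subrK; apply; have := divr_gt0 y0 x0; lra.
have h2 : 1 - x^-1 <= ln x.
  have := @le_ln1Dx R (x^-1 - 1); rewrite [1 + _]addrC subrK lnV ?posrE// => h.
  have ix : 0 < x^-1 by rewrite invr_gt0.
  by have := h; lra.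
rewrite ler_pdivlMr// mulrAC ler_pdivrMr//.
have xi : x * x^-1 = 1 by rewrite mulfV// gt_eqF.
have ix : 0 < x^-1 by rewrite invr_gt0.
have : (x - 1) * (ln y - ln x) <= (x - 1) * ((y - x) / x).
  by rewrite ler_wpM2l; [|lra|rewrite mulrBl mulfV ?gt_eqF].
have : (y - x) * (1 - x^-1) <= (y - x) * ln x.
  by rewrite ler_wpM2l//; lra.
have -> : (x - 1) * ((y - x) / x) = (y - x) * (1 - x^-1).
  by field; rewrite gt_eqF.
lra.
Qed.

Lemma w_homo (R : realType) (y a b : R) : 1 < y -> 0 < a -> 1 <= ln a -> a <= b ->
  w y a <= w y b.
Proof.
move=> y1 a0 la ab; rewrite /w.
have ly : 0 < ln y by rewrite ln_gt0.
have h1 : y / b <= y / a.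
  by rewrite ler_wpM2l ?lef_pV2 ?posrE//; lra.
have h2 : (y - 1) / ln y * (ln b / b) <= (y - 1) / ln y * (ln a / a).
  rewrite ler_wpM2l ?ln_div_antitone//; rewrite divr_ge0//; lra.
lra.
Qed.

Lemma w_antitone (R : realType) (x y a : R) : 1 < x -> x <= y -> 1 <= a ->
  w y a <= w x a.
Proof.
move=> x1 xy a1; have a0 : 0 < a by lra.
have h1 : x / a <= y / a by rewrite ler_wpM2r// invr_ge0 ltW.
have h2 : (x - 1) / ln x * (ln a / a) <= (y - 1) / ln y * (ln a / a).
  by rewrite ler_wpM2r ?sub1_div_ln_homo// divr_ge0 ?ln_ge0// ltW.
rewrite /w; lra.
Qed.

Lemma w_le1 (R : realType) (y a : R) : 1 < y -> 1 <= a -> w y a <= 1.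
Proof.
move=> y1 a1; have h1 : 0 <= y / a by rewrite divr_ge0//; lra.
have h2 : 0 <= (y - 1) / ln y * (ln a / a).
  by rewrite mulr_ge0// divr_ge0 ?ln_ge0//; lra.
rewrite /w; lra.
Qed.

Lemma sum_inv_pow (R : realType) (x : R) (K : nat) : x != 0 ->
  (x - 1) * \sum_(0 <= k < K) x ^- k.+1 = 1 - x ^- K.
Proof.
move=> x0; elim: K => [|K IH]; first by rewrite big_geq// mulr0 expr0 invr1 subrr.
rewrite big_nat_recr//= mulrDr IH exprS invfM.
by field; rewrite x0 expf_neq0.
Qed.

(** With [K] the truncation point, the geometric sum gives [l - l p^-K - (p - 1) K]. The corrections
    in [l * w_p(l)] are the bounds [l p^-K <= p], from [l < p^(K+1)], and [K <= ln l / ln p], from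
    [p^K <= l]. *)
Lemma logn_fact_ge (R : realType) (p l : nat) : prime p -> (0 < l)%N ->
  l%:R * w p%:R l%:R <= (p%:R - 1) * (logn p (l - 1)`!)%:R :> R.
Proof.
move=> pp l0; have p1 := prime_gt1 pp; have p0 := prime_gt0 pp.
pose K := trunc_log p l.
have /andP[Kl lK] : (p ^ K <= l < p ^ K.+1)%N by exact: trunc_log_bounds.
have K_lt : (K < l)%N by apply: leq_trans Kl; exact: ltn_expl.
have x1 : 1 < p%:R :> R by rewrite ltr1n.
have x0 : 0 < p%:R :> R by rewrite ltr0n.
have lr0 : 0 < l%:R :> R by rewrite ltr0n.
have lnp : 0 < ln (p%:R : R) by rewrite ln_gt0.
have v_ge : \sum_(0 <= k < K) (l%:R * p%:R ^- k.+1 - 1) <=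
    (logn p (l - 1)`!)%:R :> R.
  rewrite logn_fact// subn1 prednK// big_add1 natr_sum.
  rewrite [leRHS](@big_cat_nat _ _ _ K)//=; last by rewrite -ltnS prednK.
  apply: (@le_trans _ _ (\sum_(0 <= k < K) (l.-1 %/ p ^ k.+1)%:R)).
    apply: ler_sum => k _.
    have pk0 : 0 < p%:R ^+ k.+1 :> R by rewrite exprn_gt0.
    (* For an integer [q] one has [floor((l-1)/q) + 1 >= l/q], so replacing [l] by [l - 1] costs
       nothing beyond the [1] already conceded to the floor. *)
    rewrite lerBlDr natr1 ler_pdivrMr// -natrX -natrM ler_nat.
    by rewrite -[X in (X <= _)%N](prednK l0) ltn_ceil// expn_gt0 p0.
  by rewrite lerDl sumr_ge0.
have KlnP : K%:R * ln (p%:R : R) <= ln l%:R.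
  by rewrite mulr_natl -lnXn// ler_ln ?posrE ?exprn_gt0// -natrX ler_nat.
have lpK : l%:R * p%:R ^- K <= p%:R :> R.
  by rewrite ler_pdivrMr ?exprn_gt0// -exprS -natrX ler_nat ltnW.
apply: (@le_trans _ _ ((p%:R - 1) * \sum_(0 <= k < K) (l%:R * p%:R ^- k.+1 - 1))); last first.
  by rewrite ler_wpM2l//; lra.
have xn0 : p%:R != 0 :> R by rewrite gt_eqF.
have -> : (p%:R - 1) * \sum_(0 <= k < K) (l%:R * p%:R ^- k.+1 - 1) =
    l%:R - l%:R * p%:R ^- K - (p%:R - 1) * K%:R :> R.
  rewrite sumrB -mulr_sumr sumr_const_nat subn0.
  have := sum_inv_pow K xn0; set S := \sum_(_ <= _ < _) _ => SE.
  have -> : p%:R ^- K = 1 - (p%:R - 1) * S by rewrite SE; ring.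
  by ring.
have -> : l%:R * w p%:R l%:R = l%:R - p%:R - (p%:R - 1) * (ln l%:R / ln p%:R) :> R.
  by rewrite /w; field; rewrite !gt_eqF.
have : K%:R <= ln l%:R / ln p%:R :> R by rewrite ler_pdivlMr.
move=> h; have : (p%:R - 1) * K%:R <= (p%:R - 1) * (ln l%:R / ln p%:R) :> R.
  by rewrite ler_wpM2l//; lra.
lra.
Qed.

Section bounds.
Variables (R : realType) (m : nat).
Hypothesis m2 : (2 <= m)%N.

(** The constant is [(2/3)^2], as [ln m >= 1 - 1/m >= 2/3] for [m >= 3]. For [m = 2], [e >= 2]
    suffices. *)
Lemma s_ge_linear : 4 / 9 * m%:R <= s R m.
Proof.
rewrite /s; case: eqP => [->|/eqP mn2].
  have := @expR_ge1Dx R 1; lra.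
have m3 : 3 <= m%:R :> R by rewrite ler_nat ltn_neqAle eq_sym mn2.
have m0 : 0 < m%:R :> R by lra.
have ln_ge : 2 / 3 <= ln (m%:R : R).
  have := @le_ln1Dx R (m%:R^-1 - 1); rewrite [1 + _]addrC subrK lnV ?posrE//.
  have : m%:R^-1 <= 3^-1 :> R by rewrite lef_pV2 ?posrE.
  have : 0 < m%:R^-1 :> R by rewrite invr_gt0.
  lra.
rewrite mulrC ler_wpM2l ?(ltW m0)// (_ : 4 / 9 = (2 / 3) ^+ 2); last by field.
by rewrite lerXn2r ?nnegrE//; lra.
Qed.

Lemma s_ge1 : 1 <= s R m.
Proof.
have := s_ge_linear; have [->|mn2] := eqVneq m 2%N.
  by move=> _; rewrite /s eqxx; have := @expR_ge1Dx R 1; lra.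
have m3 : 3 <= m%:R :> R by rewrite ler_nat ltn_neqAle eq_sym mn2.
lra.
Qed.

Let X : R := s R m * expR (s R m).

Lemma ln_sexp : ln X = ln (s R m) + s R m.
Proof. by rewrite lnM ?posrE ?expR_gt0 ?expRK//; have := s_ge1; lra. Qed.

Lemma ln_sexp_ge1 : 1 <= ln X.
Proof. by rewrite ln_sexp; have := s_ge1; have := ln_ge0 s_ge1; lra. Qed.

Lemma sexp_ge1 : 1 <= X.
Proof. 
have := s_ge1; have := expR_ge1Dx (s R m); rewrite /X; nra.
Qed.

(** Both [y] and [(y - 1) / ln y] are at most [m], and [ln X <= 2 s], so the loss is at most
    [m (1 + 2 s) / X <= 3 m s / X]. From [exp s >= s^2 / 4] and [s >= 4 m / 9] follows
    [X >= (4/81) m^2 s]. The loss is thus at most [(243/4) / m], and [61] is [243/4] rounded up. *)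
Lemma w_sexp_ge : 1 - 61 / m%:R <= w ((m%:R + 1) / 2) X.
Proof.
have s1 := s_ge1; have sm := s_ge_linear; have X1 := sexp_ge1; have lX := ln_sexp.
have m2' : 2 <= m%:R :> R by rewrite ler_nat.
have X0 : 0 < X by lra.
have lns : ln (s R m) <= s R m by rewrite ltW// ln_sublinear//; lra.
have lns0 := ln_ge0 s1.
set y := (m%:R + 1) / 2.
have y1 : 1 < y by rewrite /y; lra.
have ym : y <= m%:R by rewrite /y; lra.
have lny : 0 < ln y by rewrite ln_gt0.
have ylny : (y - 1) / ln y <= m%:R.
  rewrite ler_pdivrMr//; have := @le_ln1Dx R (y^-1 - 1).
  rewrite [1 + _]addrC subrK lnV ?posrE; last lra.
  have y0 : 0 < y by lra.
  have iy0 : 0 < y^-1 by rewrite invr_gt0.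
  have yy : y * y^-1 = 1 by rewrite mulfV// gt_eqF.
  move=> h; have {}h : 1 - y^-1 <= ln y by lra.
  have : y * (1 - y^-1) <= y * ln y by rewrite ler_wpM2l// ltW.
  have : y * ln y <= m%:R * ln y by rewrite ler_wpM2r// ltW.
  by rewrite mulrBr yy; lra.
have e1 : y / X <= m%:R / X by rewrite ler_wpM2r// invr_ge0 ltW.
have e2 : (y - 1) / ln y * (ln X / X) <= m%:R * (2 * s R m) / X.
  rewrite -[leRHS]mulrA; apply: ler_pM => //; rewrite ?divr_ge0//; try lra.
  by rewrite ler_wpM2r ?invr_ge0; lra.
have exps : s R m ^+ 2 / 4 <= expR (s R m).
  have -> : expR (s R m) = expR (s R m / 2) ^+ 2 by rewrite -expRM_natl; congr expR; lra.
  have -> : s R m ^+ 2 / 4 = (s R m / 2) ^+ 2 by lra.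
  by rewrite lerXn2r ?nnegrE ?expR_ge0//; have := expR_ge1Dx (s R m / 2); lra.
have e3 : m%:R / X + m%:R * (2 * s R m) / X <= 61 / m%:R.
  rewrite -mulrDl ler_pdivrMr// mulrAC ler_pdivlMr; last lra.
  have h1 : 0 <= s R m * (expR (s R m) - s R m ^+ 2 / 4) by rewrite mulr_ge0//; lra.
  have h2 : 0 <= (s R m - 4 / 9 * m%:R) * (s R m + 4 / 9 * m%:R) by rewrite mulr_ge0//; lra.
  have h3 : 0 <= (s R m * s R m - 16 / 81 * m%:R ^+ 2) * s R m by rewrite mulr_ge0//; lra.
  have h4 : 0 <= m%:R ^+ 2 * (s R m - 1) by rewrite mulr_ge0 ?sqr_ge0//; lra.
  by move: X0; rewrite /X; lra.
rewrite /w; lra.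
Qed.

End bounds.

(** * The lower bounds for [D] and [kappa_m], and the limit *)

Lemma logprime_weight_ge0 (R : realType) (p : nat) : prime p ->
  0 <= ln (p%:R : R) / (p%:R - 1).
Proof.
move=> /prime_gt1 p1; have : 1 < p%:R :> R by rewrite ltr1n.
by move=> h; rewrite divr_ge0 ?ln_ge0//; lra.
Qed.

Lemma half_bound (R : realType) (m p : nat) : (p < ((m + 1)./2).+1)%N ->
  p%:R <= (m%:R + 1) / 2 :> R.
Proof.
move=> pm; have h : (p * 2 <= m + 1)%N by lia.
have : (p * 2)%:R <= (m + 1)%:R :> R by rewrite ler_nat.
by rewrite natrM natrD; lra.
Qed.

Lemma D_ge_exp_kappa (R : realType) (m l : nat) : (2 <= m)%N ->
  s R m * expR (s R m) <= l%:R -> expR (kappa_m R m * m%:R * l%:R) <= (D m l)%:R.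
Proof.
move=> m2 Xl; have X1 := sexp_ge1 R m2; have lX := ln_sexp_ge1 R m2.
have m0 : m%:R != 0 :> R by rewrite pnatr_eq0 -lt0n (ltnW m2).
have l0 : (0 < l)%N by rewrite -(ltr0n R); lra.
rewrite /kappa_m [_ * m%:R]mulrC mulVKf// mulr_suml expR_sum /D natr_prod.
apply: ler_prod => p pp; rewrite expR_ge0/=.
have p1 : 1 < p%:R :> R by rewrite ltr1n prime_gt1.
have p0 : (p%:R : R) \is Num.pos by rewrite posrE; lra.
rewrite natrX -[X in X ^+ _](lnK p0) -expRM_natl ler_expR natrM.
have h : l%:R * w p%:R (s R m * expR (s R m)) <=
    (p%:R - 1) * (logn p (l - 1)`!)%:R.
  apply: le_trans (logn_fact_ge R pp l0); rewrite ler_wpM2l// w_homo//; lra.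
have a0 : 0 <= (mu m p)%:R * (ln p%:R / (p%:R - 1)) :> R.
  by rewrite mulr_ge0// logprime_weight_ge0.
apply: (le_trans _ (le_trans (ler_wpM2l a0 h) _)); first by rewrite -!mulrA [w _ _ * _]mulrC.
rewrite le_eqVlt; apply/orP; left; apply/eqP.
by field; rewrite subr_eq0 gt_eqF.
Qed.

Lemma kappa_m_ge (R : realType) (m : nat) : (2 <= m)%N ->
  w ((m%:R + 1) / 2) (s R m * expR (s R m))
    * ((m%:R)^-1 * \sum_(p < ((m + 1)./2).+1 | prime p)
         (((m + 1) %/ p)%:R - 1) * (ln (p%:R : R) / (p%:R - 1)))
  <= kappa_m R m.
Proof.
move=> m2; have X1 := sexp_ge1 R m2; have lX := ln_sexp_ge1 R m2.
rewrite /kappa_m mulrCA ler_wpM2l ?invr_ge0// mulr_sumr.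
apply: ler_sum => p pp.
have p1 := prime_gt1 pp.
have pm : (nat_of_ord p * 2 <= m + 1)%N by have := ltn_ord p; lia.
rewrite muE; last by lia.
have q1 : (0 < (m + 1) %/ p)%N by rewrite divn_gt0; lia.
rewrite natrB// mulrC ler_wpM2l//.
  by rewrite mulr_ge0 ?logprime_weight_ge0// subr_ge0 ler1n.
by apply: w_antitone => //; [rewrite ltr1n|exact: half_bound].
Qed.

(** From above, [kappa_m <= kappa] for every [m >= 2], because [mu_p / m <= 1/p] and [w <= 1]. From
    below, only the primes under a fixed [P] are kept, so the rounding loss is the constant
    [2 * A P] divided by [m], and no estimate of a prime sum growing with [m] is required. *)
Lemma cvg_kappa_m (R : realType) :
  series (kappa_term R) @ \oo --> kappa R -> kappa_m R @ \oo --> kappa R.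
Proof.
move=> ck.
pose wm (m : nat) : R := w ((m%:R + 1) / 2) (s R m * expR (s R m)).
have t0 p : 0 <= kappa_term R p.
  rewrite /kappa_term; case: ifP => // /prime_gt1 p1.
  have : 1 < p%:R :> R by rewrite ltr1n.
  by move=> h; rewrite divr_ge0 ?ln_ge0 ?mulr_ge0//; lra.
have term_le P : series (kappa_term R) P <= kappa R.
  rewrite -(cvg_lim _ ck)//; apply: nondecreasing_cvgn_le.
    exact: nondecreasing_series.
  by apply/cvg_ex; exists (kappa R).
have cvinv : (fun m : nat => (m%:R : R)^-1) @ \oo --> (0 : R).
  rewrite -cvg_shiftS /=; exact: cvg_harmonic.
have cwm : wm @ \oo --> (1 : R).
  have c1 : (fun m : nat => 1 - 61 / m%:R) @ \oo --> (1 : R).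
    rewrite -[X in _ --> X](_ : 1 - 61 * 0 = 1); last by rewrite mulr0 subr0.
    by apply: cvgB; [exact: cvg_cst|exact: cvgMr].
  have c2 : (fun _ : nat => 1 : R) @ \oo --> (1 : R) by exact: cvg_cst.
  apply: (squeeze_cvgr _ c1 c2); near=> m.
  have m2 : (2 <= m)%N by near: m; exact: nbhs_infty_ge.
  rewrite w_sexp_ge//= w_le1//; last exact: sexp_ge1.
  by have : 2 <= m%:R :> R; [rewrite ler_nat|lra].
pose A P : R := \sum_(0 <= p < P | prime p) ln p%:R / (p%:R - 1).
have lower P m : (2 <= m)%N -> (P <= m./2)%N -> 0 <= wm m ->
    wm m * (series (kappa_term R) P - 2 * A P / m%:R) <= kappa_m R m.
  move=> m2 Pm w0; apply: le_trans (kappa_m_ge R m2); rewrite ler_wpM2l//.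
  have m0 : 0 < m%:R :> R by rewrite ltr0n (ltnW m2).
  rewrite -(big_mkord prime (fun p => (((m + 1) %/ p)%:R - 1) * (ln p%:R / (p%:R - 1)))).
  rewrite (@big_cat_nat _ _ _ P)//=; last by lia.
  have pos a b : (b <= (m + 1)./2.+1)%N -> 0 <= \sum_(a <= p < b | prime p)
      (((m + 1) %/ p)%:R - 1) * (ln p%:R / (p%:R - 1)) :> R.
    move=> bm; rewrite big_nat_cond sumr_ge0// => p /andP[/andP[_ pb] pp].
    rewrite mulr_ge0 ?logprime_weight_ge0// subr_ge0 ler1n divn_gt0 ?prime_gt0//; lia.
  rewrite ler_pdivlMl// (le_trans _ (lerD (lexx _) (pos P _ _)))// addr0.
  rewrite mulrBr (_ : m%:R * (2 * A P / m%:R) = 2 * A P); last by field; rewrite gt_eqF.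
  rewrite /series/= /A !mulr_sumr [X in _ - X]big_mkcond [leRHS]big_mkcond -sumrB /=.
  apply: ler_sum => p _; rewrite /kappa_term; case: ifP => pp; last by rewrite mulr0 subrr.
  have p1 := prime_gt1 pp; have p1' : 1 < p%:R :> R by rewrite ltr1n.
  have p0 : 0 < p%:R :> R by lra.
  have -> : m%:R * (ln p%:R / (p%:R * (p%:R - 1))) - 2 * (ln p%:R / (p%:R - 1)) =
      (m%:R / p%:R - 2) * (ln p%:R / (p%:R - 1)) :> R.
    by field; rewrite subr_eq0 !gt_eqF.
  rewrite ler_wpM2r ?logprime_weight_ge0// lerBlDr.
  (* The claim [m/p - 2 <= floor((m+1)/p) - 1] reduces to [m/p <= floor((m+1)/p) + 1]. *)
  rewrite (_ : _ - 1 + 2 = ((m + 1) %/ p).+1%:R); last by rewrite -natr1; ring.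
  rewrite ler_pdivrMr// -natrM ler_nat.
  by have := ltn_ceil (m + 1) (ltnW p1); lia.
have upper m : (2 <= m)%N -> kappa_m R m <= kappa R.
  move=> m2; apply: (le_trans _ (term_le ((m + 1)./2).+1)).
  have m0 : 0 < m%:R :> R by rewrite ltr0n (ltnW m2).
  rewrite /kappa_m /series/= big_mkord mulr_sumr big_mkcond/=; apply: ler_sum => p _.
  rewrite /kappa_term; case: ifP => // pp.
  have p1 := prime_gt1 pp; have p1' : 1 < (p : nat)%:R :> R by rewrite ltr1n.
  have p0 : 0 < (p : nat)%:R :> R by lra.
  have pm := half_bound R (ltn_ord p).
  have pm2 : (nat_of_ord p * 2 <= m + 1)%N by have := ltn_ord p; lia.
  have a0 := logprime_weight_ge0 R pp.
  have w1 : w p%:R (s R m * expR (s R m)) <= 1 by rewrite w_le1// sexp_ge1.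
  (* Here [p * mu_p = p * floor((m+1)/p) - p <= m + 1 - p <= m]. *)
  have mu_le : (mu m p)%:R <= m%:R / p%:R :> R.
    rewrite ler_pdivlMr// -natrM ler_nat muE; last by lia.
    have := leq_trunc_div (m + 1) p; rewrite mulnBl mul1n; lia.
  apply: (@le_trans _ _ (m%:R^-1 * ((mu m p)%:R * (ln p%:R / (p%:R - 1))))).
    rewrite ler_wpM2l ?invr_ge0// -[leRHS]mulr1 ler_wpM2l// mulr_ge0//.
  have -> : ln p%:R / (p%:R * (p%:R - 1)) =
      m%:R^-1 * (m%:R / p%:R * (ln p%:R / (p%:R - 1))) :> R.
    by field; rewrite subr_eq0 !gt_eqF.
  by rewrite ler_wpM2l ?invr_ge0// ler_wpM2r.
apply/cvgrPdist_le => e e0.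
have [P hP] : exists P, kappa R - e < series (kappa_term R) P.
  have := cvgr_gt _ ck (kappa R - e); rewrite gtrBl => /(_ _ e0)[P _ hP].
  by exists P; apply: hP => /=.
have clow : (fun m => wm m * (series (kappa_term R) P - 2 * A P / m%:R)) @ \oo -->
    1 * (series (kappa_term R) P - 2 * A P * 0).
  by apply: cvgM => //; apply: cvgB; [exact: cvg_cst|exact: cvgMr].
rewrite mul1r mulr0 subr0 in clow.
have ev : \forall m \near \oo,
    kappa R - e <= wm m * (series (kappa_term R) P - 2 * A P / m%:R).
  exact: (cvgr_ge _ clow).
near=> m.
have m2 : (2 <= m)%N by near: m; exact: nbhs_infty_ge.
have Pm : (P <= m./2)%N.
  have : (P.*2 <= m)%N by near: m; exact: nbhs_infty_ge.
  lia.
have w0 : 0 <= wm m by near: m; apply: (cvgr_ge _ cwm); exact: ltr01.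
have lo : kappa R - e <= wm m * (series (kappa_term R) P - 2 * A P / m%:R).
  by near: m.
have := upper m m2; have := lower P m m2 Pm w0 => h1 h2.
by rewrite ger0_norm ?subr_ge0//; lra.
Unshelve. all: by end_near. Qed.

Theorem theorem6p4 (R : realType) :
  (forall m l : nat, (2 <= m)%N -> s R m * expR (s R m) <= l%:R ->
     expR (kappa_m R m * m%:R * l%:R) <= (D m l)%:R)
  /\
  (forall m : nat, (2 <= m)%N ->
     w ((m%:R + 1) / 2) (s R m * expR (s R m))
       * ((m%:R)^-1 * \sum_(p < ((m + 1)./2).+1 | prime p)
            (((m + 1) %/ p)%:R - 1) * (ln (p%:R : R) / (p%:R - 1)))
     <= kappa_m R m)
  /\
  kappa_m R @ \oo --> kappa R
  /\
  (series (kappa_term R) : R ^nat) @ \oo --> kappa R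
  /\
  kappa_approx R <= kappa R < kappa_approx R + (10%:R ^+ 11)^-1.
Proof.
have [ck kv] := kappa_value R.
split; first by move=> m l; exact: D_ge_exp_kappa.
split; first by move=> m; exact: kappa_m_ge.
by split; [exact: cvg_kappa_m|split].
Qed.
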